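(* Let $k$ and $n$ be coprime and let $q$ be a prime power coprime to $n$. Let $\Pi_{k,n}^\circ$ be the top-dimensional open positroid variety, $T$ the diagonal (split) maximal torus of $\mathrm{PGL}(n)_{\mathbb{F}_q}$, $T'$ an anisotropic maximal torus of $\mathrm{PGL}(n)_{\mathbb{F}_q}$, and $\Pi_{k,n}^{\circ'}$ the twisted top-dimensional open positroid variety over $\mathbb{F}_q$ (all as defined in the context). Then $$\frac{|\Pi_{k,n}^\circ(\mathbb{F}_q)|}{|T(\mathbb{F}_q)|}=\frac{|\Pi_{k,n}^{\circ'}(\mathbb{F}_q)|}{|T'(\mathbb{F}_q)|}=\frac{|\mathrm{Gr}(k,n)(\mathbb{F}_q)|}{|T'(\mathbb{F}_q)|}.$$
   Context: Here $1\le k\le n$ are integers. $\mathrm{Gr}(k,n)$ is the Grassmannian of $k$-dimensional subspaces of $n$-dimensional space. For a $k$-subset $I\subset\{1,\dots,n\}$, $\Delta_I(V)$ is the Plücker coordinate, i.e. the $k\times k$ minor with column set $I$ of a $k\times n$ matrix whose rows form a basis of $V$ (up to a common nonzero scalar). For $r\in\mathbb{Z}/n\mathbb{Z}$ let $I_r=\{r+1,\dots,r+k\}$, indices modulo $n$. Define $$\Pi_{k,n}^\circ=\{V\in\mathrm{Gr}(k,n)\mid\Delta_{I_r}(V)\neq0\text{ for all }r\in\mathbb{Z}/n\mathbb{Z}\}.$$ $T\cong\mathbb{G}_m^n/\mathbb{G}_m$ is the diagonal torus of $\mathrm{PGL}(n)_{\mathbb{F}_q}$, so $T(\mathbb{F}_q)=(\mathbb{F}_q^\times)^n/\mathbb{F}_q^\times$;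 $T'$ is an anisotropic maximal torus of $\mathrm{PGL}(n)_{\mathbb{F}_q}$, so $T'(\mathbb{F}_q)=\mathbb{F}_{q^n}^\times/\mathbb{F}_q^\times$. Let $\rho$ be the cyclic permutation matrix $\rho(e_i)=e_{i+1}$ for $1\le i\le n-1$, $\rho(e_n)=e_1$. Let $\mathrm{Fr}_q$ be the geometric Frobenius, i.e. the inverse of $a\mapsto a^q$, acting on the entries of matrices over $\mathbb{F}_{q^n}$. Fix $g\in\mathrm{PGL}(n)(\mathbb{F}_{q^n})$ such that $gTg^{-1}=T'$ and $g^{-1}\mathrm{Fr}_q(g)$ is the image of $\rho$ in $\mathrm{PGL}(n)(\mathbb{F}_q)$ (such a $g$ exists). The twisted top-dimensional open positroid variety is $$\Pi_{k,n}^{\circ'}=\{V\in\mathrm{Gr}(k,n)\mid\Delta_{I_r}(g^{-1}V)\neq0\text{ for all }r\in\mathbb{Z}/n\mathbb{Z}\}.$$ Since $g^{-1}\mathrm{Fr}_q(g)=\rho$ and $\Pi_{k,n}^\circ$ is $\rho$-stable, this open subset of $\mathrm{Gr}(k,n)$ is defined over $\mathbb{F}_q$; its $\mathbb{F}_q$-points are the $V\in\mathrm{Gr}(k,n)(\mathbb{F}_q)$ with $\Delta_{I_r}(g^{-1}V)\ne0$ for all $r$. *)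

(* Defs.v *)
From HB Require Import structures.
From mathcomp Require Import all_boot all_order all_algebra.

Set Implicit Arguments.
Unset Strict Implicit.
Unset Printing Implicit Defensive.

Import GRing.Theory.
Local Open Scope ring_scope.

(* Subspaces of K^n are row spaces; [<<A>>%MS] is the canonical square matrix
   with the same row space as A, so distinct elements are distinct subspaces. *)
Definition Gr (K : finFieldType) (k n : nat) : {set 'M[K]_n} :=
  [set <<A>>%MS | A : 'M[K]_n & \rank A == k].

(* Pluecker coordinate of the row space V with respect to the basis
   [row_base V].  The columns are given as a family c rather than as a set:
   listing the same columns in another order changes only the sign. *)
Definition plucker (K : fieldType) (n : nat) (V : 'M[K]_n)
    (c : 'I_(\rank V) -> 'I_n) : K :=
  \det (colsub c (row_base V)).
Arguments plucker {K n} V c.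

(* The k cyclically consecutive columns starting with the 0-based column r,
   i.e. {r + 1, ..., r + k} modulo n when columns are numbered from 1. *)
Definition cyclic_interval (k n : nat) (r : 'I_n) (j : 'I_k) : 'I_n :=
  iter j (@ordS n) r.

Definition cyclic_minors_neq0 (K : fieldType) (n : nat) (V : 'M[K]_n) : bool :=
  [forall r : 'I_n, plucker V (cyclic_interval r) != 0].

Definition open_positroid (K : finFieldType) (k n : nat) : {set 'M[K]_n} :=
  [set V in Gr K k n | cyclic_minors_neq0 V].

(* A matrix g acts on column vectors, v |-> g v, hence by right multiplication
   with the transpose on subspaces given as row spaces. *)
Definition subspace_act (K : fieldType) (n : nat) (g V : 'M[K]_n) : 'M[K]_n :=
  V *m g^T.

(* F-points of the twisted variety: the subspaces are defined over F, the
   minors of g^-1 V are taken over L. *)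
Definition twisted_open_positroid (F L : finFieldType)
    (iota : {rmorphism F -> L}) (k n : nat) (g : 'M[L]_n) : {set 'M[F]_n} :=
  [set V in Gr F k n |
    cyclic_minors_neq0 (subspace_act (invmx g) (map_mx iota V))].

(* The class of A modulo nonzero scalars.  For A in [unitmx] this is the image
   of A in PGL_n(K) = GL_n(K) / K^*. *)
Definition pgl (K : finFieldType) (n : nat) (A : 'M[K]_n) : {set 'M[K]_n} :=
  [set c *: A | c : K & c != 0].

Definition diag_torus (K : finFieldType) (n : nat) : {set {set 'M[K]_n}} :=
  [set pgl D | D : 'M[K]_n & (D \in unitmx) && is_diag_mx D].

(* g T g^-1.  When g^-1 Fr(g) is the image of the n-cycle rho, Frobenius
   permutes the n coordinates of T cyclically, so this torus is defined over the
   small field and is anisotropic there. *)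
Definition conj_diag_torus (K : finFieldType) (n : nat) (g : 'M[K]_n) :
    {set {set 'M[K]_n}} :=
  [set pgl (g *m D *m invmx g) | D : 'M[K]_n & (D \in unitmx) && is_diag_mx D].

(* The elements of PGL_n(F) whose image in PGL_n(L) lies in S. *)
Definition pgl_rational_points (F L : finFieldType)
    (iota : {rmorphism F -> L}) (n : nat) (S : {set {set 'M[L]_n}}) :
    {set {set 'M[F]_n}} :=
  [set pgl A | A : 'M[F]_n &
    (A \in unitmx) && (pgl (map_mx iota A) \in S)].

(* [finv] is the inverse function, x |-> x ^+ q being injective when q is a
   power of the characteristic of the finite field L. *)
Definition geometric_frobenius (L : finFieldType) (q : nat) : L -> L :=
  finv (fun x : L => x ^+ q).

(* rho e_j = e_(j+1), indices modulo n *)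
Definition cyclic_perm_mx (K : fieldType) (n : nat) : 'M[K]_n :=
  \matrix_(i < n, j < n) (i == ordS j)%:R.

(* Main.v *)
(* Counting the points of the split variety amounts to counting the k x n
   matrices over F_q all of whose cyclic windows of k columns are invertible,
   that is closed walks of length n on GL_k(F_q).  On the functions invariant
   under the upper triangular group, one step of such a walk acts, up to a
   scalar, as the Coxeter element c = T_1 ... T_(k-1) of the Iwahori-Hecke
   algebra, so the count is (q - 1)^n tr(c^n).  The full twist c^k is central
   and acts by a scalar on each hook idempotent.  As c has nonzero trace on hooks
   only, tr(c^(1 + k m)) is an explicit combination of the powers
   q^(a (1 + k m)), 0 <= a < k, with rational coefficients.  The Galois action
   on k-th roots of unity extends this formula from exponents 1 + k m to all
   exponents prime to k, and for exponent n the q-binomial theorem gives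
   (q^n - 1) tr(c^n) = (q^n - 1) (q^n - q) ... (q^n - q^(k-1)), the number of
   k x n matrices of rank k.
   In the twisted form Frobenius permutes the columns of g^-1 V cyclically up to
   scalars, so a dependency within one window would confine all columns to a
   proper subspace: every V in Gr(k, n)(F_q) lies in the twisted variety. *)

Require Import Defs.
From HB Require Import structures.
From mathcomp Require Import all_boot all_order all_algebra.
From mathcomp Require Import all_fingroup all_field mxred spectral ring zify.

Set Implicit Arguments.
Unset Strict Implicit.
Unset Printing Implicit Defensive.

Import Order.TTheory GRing.Theory Num.Theory.
Local Open Scope ring_scope.

(** * Hecke relations, q-symmetrizers and the q-binomial theorem *)

(** The Hecke algebra acts on the functions on the flag variety of F^k, where the trace of T_w
    vanishes for w different from 1. What is used of this, read off from supports on parabolic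
    subgroups, is that T_j is orthogonal to all expressions avoiding T_j. It fixes the trace on
    products of a symmetrizer and an antisymmetrizer: [k]! / ([a]! [k-a]!_(1/q)). Hooks enter only
    through such products, by the Pieri rule, so no character table is needed; and these values are
    both rational, as the Galois step requires, and the coefficients of the q-binomial theorem. The
    Galois step answers an obstacle: only c^k is central, so the twist gives tr(c^m) for m = 1 mod k
    alone and sees the eigenvalues of c up to k-th roots of unity. A walk step is not
    Borel-invariant by itself, as it averages over changes of the last column only. Behind the Borel
    idempotent this average does the same as the Borel average, and k steps renew every column of a
    window; so the two traces agree from exponent k on, which is where k <= n enters. *)

Definition qnum (K : pzRingType) (q : K) (n : nat) : K := \sum_(i < n) q ^+ i.

Definition qfact (K : pzRingType) (q : K) (n : nat) : K :=
  \prod_(i < n) qnum q i.+1.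

Section QNumbers.
Variable K : numFieldType.
Implicit Types (q : K) (m n : nat).

Lemma qnum0 q : qnum q 0 = 0. Proof. by rewrite /qnum big_ord0. Qed.

Lemma qnum1 q : qnum q 1 = 1. Proof. by rewrite /qnum big_ord1. Qed.

Lemma qnumS q n : qnum q n.+1 = 1 + q * qnum q n.
Proof.
rewrite /qnum big_ord_recl expr0 mulr_sumr; congr (_ + _).
by apply: eq_bigr => i _; rewrite exprS.
Qed.

Lemma qnumD q m n : qnum q (m + n) = qnum q m + q ^+ m * qnum q n.
Proof.
elim: m => [|m IH]; first by rewrite qnum0 expr0 mul1r add0r.
by rewrite addSn !qnumS IH exprS; ring.
Qed.

Lemma qnum_gt0 q n : 0 < q -> 0 < qnum q n.+1.
Proof.
move=> q0; elim: n => [|n IH]; first by rewrite qnum1.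
by rewrite qnumS addr_gt0 ?ltr01 // mulr_gt0.
Qed.

Lemma qnum_neq0 q n : 0 < q -> qnum q n.+1 != 0.
Proof. by move=> q0; rewrite gt_eqF ?qnum_gt0. Qed.

Lemma qnumV q n : q != 0 -> q ^+ n * qnum q^-1 n.+1 = qnum q n.+1.
Proof.
move=> q0; elim: n => [|n IH]; first by rewrite expr0 mul1r !qnum1.
have -> : qnum q n.+2 = qnum q n.+1 + q ^+ n.+1.
  by rewrite -(addn1 n.+1) qnumD qnum1 mulr1.
by rewrite (qnumS _ n.+1) -IH exprS; field.
Qed.

Lemma qnum_geom q n : (q - 1) * qnum q n = q ^+ n - 1.
Proof. by rewrite [RHS]subrX1. Qed.

Lemma qfactS q n : qfact q n.+1 = qfact q n * qnum q n.+1.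
Proof. by rewrite /qfact big_ord_recr. Qed.

Lemma qfact_neq0 q n : 0 < q -> qfact q n != 0.
Proof. by move=> q0; apply/prodf_neq0 => i _; apply: qnum_neq0. Qed.

(** Since [b]!_(1/q) = q^(-C(b,2)) [b]!_q, the mixed factorials absorb the power of q of the usual
    form; the traces below produce the coefficients in this shape. The induction rests on the Pascal
    rule [w_pascal]. *)
Lemma q_binomial_theorem q (x : K) k : 0 < q ->
  \sum_(a < k.+1) (-1) ^+ (k - a) * x ^+ a
     * (qfact q k / (qfact q a * qfact q^-1 (k - a)))
  = \prod_(i < k) (x - q ^+ i).
Proof.
move=> q0; have qn0 : q != 0 by rewrite gt_eqF.
have qV0 : 0 < q^-1 by rewrite invr_gt0.
pose w n a := qfact q n / (qfact q a * qfact q^-1 (n - a)).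
have w_pascal n a : (a < n)%N -> w n.+1 a.+1 = w n a + q ^+ n * w n a.+1.
  move=> an; rewrite /w subSS.
  have -> : (n - a = (n - a.+1).+1)%N by lia.
  set b := (n - a.+1)%N; rewrite !qfactS.
  have -> : qnum q n.+1 = qnum q a.+1 + q ^+ n * qnum q^-1 b.+1.
    have -> : (n = a.+1 + b)%N by rewrite /b; lia.
    by rewrite -addnS qnumD -(qnumV b qn0) exprD; ring.
  field.
  by rewrite !qnum_neq0 ?qfact_neq0.
have w_last n : w n n = 1.
  by rewrite /w subnn [qfact _ 0]big_ord0 mulr1 divff ?qfact_neq0.
have w0 n : w n.+1 0 = q ^+ n * w n 0.
  rewrite /w !subn0 !qfactS [qfact q 0]big_ord0 -(qnumV n qn0).
  by field; rewrite !qnum_neq0 ?qfact_neq0.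
elim: k => [|k IH].
  by rewrite big_ord_recl !big_ord0 -/(w 0 0) w_last !expr0; ring.
pose F n a := (-1) ^+ (n - a) * x ^+ a * w n a.
rewrite [RHS]big_ord_recr /= -IH.
rewrite -/(w _ _) (eq_bigr (fun a : 'I__ => F k.+1 a)) //.
rewrite [in RHS](eq_bigr (fun a : 'I__ => F k a)) //.
rewrite mulrBr [in LHS]big_ord_recl [in LHS]big_ord_recr /=.
rewrite [X in X * x - _]big_ord_recr [X in _ - X * _]big_ord_recl /=.
have -> : \sum_(i < k) F k.+1 (bump 0 i)
   = (\sum_(i < k) F k i) * x - (\sum_(i < k) F k (bump 0 i)) * q ^+ k.
  rewrite !mulr_suml -sumrB; apply: eq_bigr => i _.
  rewrite /F /bump leq0n add1n subSS w_pascal //.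
  have -> : (k - i = (k - i.+1).+1)%N by have := ltn_ord i; lia.
  by rewrite !exprS; ring.
rewrite /F /bump leq0n add1n !subn0 !subnn !w_last w0 !exprS !expr0.
by ring.
Qed.

End QNumbers.

Section HeckeAlgebra.
Variables (K : numFieldType) (R : algType K).

(** Here k counts strands: the generators are T_0, ..., T_(k-2), whence the bounds [i.+1 < k]. The
    function [T] is total and unconstrained beyond them. *)
Record hecke_family (q : K) (T : nat -> R) (k : nat) : Prop := HeckeFamily {
  hecke_quad : forall i, (i.+1 < k)%N -> T i * T i = (q - 1) *: T i + q *: 1;
  hecke_braid : forall i, (i.+2 < k)%N ->
    T i * T i.+1 * T i = T i.+1 * T i * T i.+1;
  hecke_comm : forall i j, (i.+1 < j)%N -> (j.+1 < k)%N -> T i * T j = T j * T i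
}.

Lemma hecke_family_le q T k l : (l <= k)%N ->
  hecke_family q T k -> hecke_family q T l.
Proof.
move=> lk [hq hb hc]; split=> [i il|i il|i j ij jl].
- by apply: hq; lia.
- by apply: hb; lia.
- by apply: hc; lia.
Qed.

(* T -> -T/q exchanges the eigenvalues q and -1 of the generators, up to
   replacing q by 1/q. *)
Definition hecke_dual (q : K) (T : nat -> R) (i : nat) : R := - q^-1 *: T i.

Lemma hecke_family_dual q T k : q != 0 ->
  hecke_family q T k -> hecke_family q^-1 (hecke_dual q T) k.
Proof.
move=> q0 [hq hb hc]; split=> [i il|i il|i j ij jl]; rewrite /hecke_dual.
- rewrite -!scalerAl -!scalerAr hq // !scalerDr !scalerA.
  by congr (_ *: _ + _ *: _); field.
- by rewrite -!scalerAl -!scalerAr -!scalerAl -?scalerAr hb.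
- by rewrite -!scalerAl -!scalerAr hc.
Qed.

(* The idempotent of the trivial character of the parabolic subalgebra generated
   by T_i, ..., T_(i+g-1), by the recursion of Jones and Wenzl. *)
Fixpoint hecke_sym (q : K) (T : nat -> R) (i g : nat) : R :=
  if g is g'.+1 then
    let e := hecke_sym q T i g' in
    (qnum q g.+1)^-1 *: (e + qnum q g *: (e * T (i + g')%N * e))
  else 1.

Section Symmetrizer.
Variables (q : K) (T : nat -> R) (k : nat).
Local Notation sym := (hecke_sym q T).

Lemma hecke_sym_comm x i g :
  (forall j, (i <= j < i + g)%N -> T j * x = x * T j) ->
  sym i g * x = x * sym i g.
Proof.
elim: g => [|g IH] Tx /=; first by rewrite mul1r mulr1.
have ex : sym i g * x = x * sym i g by apply: IH => j hj; apply: Tx; lia.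
rewrite -scalerAl -scalerAr mulrDl mulrDr ex -scalerAl -scalerAr.
have tx : T (i + g)%N * x = x * T (i + g)%N by apply: Tx; lia.
by rewrite -!mulrA ex (mulrA (T _)) tx -mulrA (mulrA _ x) ex -mulrA.
Qed.

Hypotheses (q_gt0 : 0 < q) (TH : hecke_family q T k).

(** On a common q-eigenvector each step of the recursion acts by (1 + q [g+1]) / [g+2] = 1. *)
Lemma hecke_sym_absorbl x i g :
  (forall j, (i <= j < i + g)%N -> T j * x = q *: x) -> sym i g * x = x.
Proof.
elim: g => [|g IH] Tx /=; first by rewrite mul1r.
have ex : sym i g * x = x by apply: IH => j hj; apply: Tx; lia.
rewrite -scalerAl mulrDl -scalerAl -!mulrA ex Tx; last by lia.
rewrite -scalerAr ex -[X in X + _]scale1r !scalerA -scalerDl scalerA.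
by rewrite (mulrC _ q) -qnumS mulVf ?scale1r ?qnum_neq0.
Qed.

Lemma hecke_sym_absorbr x i g :
  (forall j, (i <= j < i + g)%N -> x * T j = q *: x) -> x * sym i g = x.
Proof.
elim: g => [|g IH] Tx /=; first by rewrite mulr1.
have ex : x * sym i g = x by apply: IH => j hj; apply: Tx; lia.
rewrite -scalerAr mulrDr -scalerAr !mulrA ex Tx; last by lia.
rewrite -scalerAl ex -[X in X + _]scale1r !scalerA -scalerDl scalerA.
by rewrite (mulrC _ q) -qnumS mulVf ?scale1r ?qnum_neq0.
Qed.

(** Induction step of [hecke_sym_mull]: e' and e are consecutive symmetrizers, t is the last
    generator of e and s the next one. By [ce] the sum equals e + s e + d e' t s e. The quadratic
    relation settles the first two terms; in the third, s passes e', and sts = tst lets t act on e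
    by q. *)
Lemma sym_stepl (c d : K) (e e' s t : R) :
  s * e' = e' * s -> e' * e = e -> t * e = q *: e ->
  c *: e = e' + d *: (e' * t * e') ->
  s * s = (q - 1) *: s + q *: 1 -> s * t * s = t * s * t ->
  s * (e + c *: (e * s * e)) = q *: (e + c *: (e * s * e)).
Proof.
move=> se' ee te ce ss sts.
have -> : c *: (e * s * e) = s * e + d *: (e' * (t * (s * e))).
  rewrite 2!scalerAl ce !mulrDl -!scalerAl -se' -!mulrA ee.
  by rewrite (mulrA e' s) -se' -(mulrA s) ee.
have sse : s * (s * e) = (q - 1) *: (s * e) + q *: e.
  by rewrite mulrA ss mulrDl -!scalerAl mul1r.
have stse : s * (e' * (t * (s * e))) = q *: (e' * (t * (s * e))).
  rewrite mulrA se' -mulrA (mulrA s t) (mulrA (s * t)) sts -!mulrA te.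
  by rewrite -!scalerAr.
rewrite !mulrDr sse -scalerAr stse !scalerDr !scalerA (mulrC d) scalerBl scale1r.
by rewrite !addrA [s * e + _]addrC addrK [q *: e + _]addrC.
Qed.

Lemma sym_stepr (c d : K) (e e' s t : R) :
  s * e' = e' * s -> e * e' = e -> e * t = q *: e ->
  c *: e = e' + d *: (e' * t * e') ->
  s * s = (q - 1) *: s + q *: 1 -> s * t * s = t * s * t ->
  (e + c *: (e * s * e)) * s = q *: (e + c *: (e * s * e)).
Proof.
move=> se' ee te ce ss sts.
have -> : c *: (e * s * e) = e * s + d *: (e * s * t * e').
  rewrite -[e * s * e]mulrA 2!scalerAr ce !mulrDr -!scalerAr.
  by rewrite !mulrA -(mulrA e s e') se' !mulrA ee.
have sse : e * s * s = (q - 1) *: (e * s) + q *: e.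
  by rewrite -mulrA ss mulrDr -!scalerAr mulr1.
have stse : e * s * t * e' * s = q *: (e * s * t * e').
  rewrite -mulrA -se' mulrA -(mulrA e s) -(mulrA e) sts !mulrA te.
  by rewrite -!scalerAl.
rewrite !mulrDl sse -scalerAl stse !scalerDr !scalerA (mulrC d) scalerBl scale1r.
by rewrite !addrA [e * s + _]addrC addrK [q *: e + _]addrC.
Qed.

Lemma hecke_sym_mull i g j : (i + g < k)%N -> (i <= j < i + g)%N ->
  T j * sym i g = q *: sym i g.
Proof.
case: TH => hq hb hc.
elim: g j => [|g IH] j ik hj; first by lia.
rewrite /= -scalerAr scalerA (mulrC q) -scalerA; congr (_ *: _).
have [jg|jg] : (j < i + g)%N \/ j = (i + g)%N by lia.
  by rewrite mulrDr -scalerAr !mulrA IH ?scalerDr -?scalerAl ?[LHS]scalerA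
    ?scalerA 1?(mulrC q) //; lia.
rewrite {j hj}jg.
case: g => [|g] in ik IH *.
  rewrite qnum1 !scale1r mul1r mulr1 addn0 mulrDr mulr1 hq; last by lia.
  by rewrite scalerBl scale1r scalerDr !addrA [T i + _]addrC addrK addrC.
apply: (@sym_stepl _ (qnum q g.+1) _ (sym i g) _ (T (i + g)%N)).
- rewrite hecke_sym_comm // => l hl; rewrite hc //; lia.
- by apply: hecke_sym_absorbl => l hl; apply: IH; lia.
- by apply: IH; lia.
- by rewrite /= scalerA divff ?scale1r ?qnum_neq0.
- by apply: hq; lia.
- by rewrite addnS; symmetry; apply: hb; lia.
Qed.

Lemma hecke_sym_mulr i g j : (i + g < k)%N -> (i <= j < i + g)%N ->
  sym i g * T j = q *: sym i g.
Proof.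
case: TH => hq hb hc.
elim: g j => [|g IH] j ik hj; first by lia.
rewrite /= -scalerAl scalerA (mulrC q) -scalerA; congr (_ *: _).
have [jg|jg] : (j < i + g)%N \/ j = (i + g)%N by lia.
  by rewrite mulrDl -scalerAl -!mulrA IH ?scalerDr -?scalerAr ?scalerA
    1?(mulrC q) //; lia.
rewrite {j hj}jg.
case: g => [|g] in ik IH *.
  rewrite qnum1 !scale1r mul1r mulr1 addn0 mulrDl mul1r hq; last by lia.
  by rewrite scalerBl scale1r scalerDr !addrA [T i + _]addrC addrK addrC.
apply: (@sym_stepr _ (qnum q g.+1) _ (sym i g) _ (T (i + g)%N)).
- rewrite hecke_sym_comm // => l hl; rewrite hc //; lia.
- by apply: hecke_sym_absorbr => l hl; apply: IH; lia.
- by apply: IH; lia.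
- by rewrite /= scalerA divff ?scale1r ?qnum_neq0.
- by apply: hq; lia.
- by rewrite addnS; symmetry; apply: hb; lia.
Qed.

Lemma hecke_sym_idem i g : (i + g < k)%N -> sym i g * sym i g = sym i g.
Proof.
by move=> ik; apply: hecke_sym_absorbl => j hj; apply: hecke_sym_mull.
Qed.

(** The recursion can also be run from the left. The right-hand side x is a q-eigenvector of every
    generator involved, so the symmetrizer fixes x; expanding the same product through x returns the
    symmetrizer. *)
Lemma hecke_sym_recl i g : (i + g.+1 < k)%N ->
  sym i g.+1 = (qnum q g.+2)^-1 *:
    (sym i.+1 g + qnum q g.+1 *: (sym i.+1 g * T i * sym i.+1 g)).
Proof.
case: (TH) => hq hb hc.
elim: g i => [|g IH] i ik; first by rewrite /= addn0.
have Te j : (i < j < i + g.+2)%N ->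
    T j * sym i.+1 g.+1 = q *: sym i.+1 g.+1.
  by move=> hj; apply: hecke_sym_mull; lia.
have eE : sym i g.+2 * sym i.+1 g.+1 = sym i g.+2.
  by apply: hecke_sym_absorbr => j hj; apply: hecke_sym_mulr; lia.
have ce : qnum q g.+2 *: sym i.+1 g.+1
    = sym i.+2 g + qnum q g.+1 *: (sym i.+2 g * T i.+1 * sym i.+2 g).
  by rewrite IH ?scalerA ?divff ?scale1r ?qnum_neq0 //; lia.
have e'e : sym i.+2 g * sym i.+1 g.+1 = sym i.+1 g.+1.
  by apply: hecke_sym_absorbl => l hl; apply: Te; lia.
move: (sym i.+1 g.+1) => e in Te eE ce e'e *; set x := _ *: _.
have Tix : T i * x = q *: x.
  rewrite /x -scalerAr scalerA (mulrC q) -scalerA; congr (_ *: _).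
  apply: (@sym_stepl _ (qnum q g.+1) _ (sym i.+2 g) _ (T i.+1)).
  - by rewrite hecke_sym_comm // => l hl; rewrite (hc i) //; lia.
  - by [].
  - by apply: Te; lia.
  - by [].
  - by apply: hq; lia.
  - by apply: hb; lia.
have Tx : sym i g.+2 * x = x.
  apply: hecke_sym_absorbl => j hj.
  have [->//|ij] : j = i \/ (i < j)%N by lia.
  rewrite /x -scalerAr scalerA (mulrC q) -scalerA; congr (_ *: _).
  by rewrite mulrDr -scalerAr !mulrA Te ?scalerDr -?scalerAl
    ?scalerA 1?(mulrC q) //; lia.
rewrite -Tx /x -scalerAr mulrDr -scalerAr !mulrA eE.
rewrite hecke_sym_mulr; try lia.
rewrite -scalerAl eE; move: (sym i g.+2) => s.
rewrite -[X in X + _]scale1r !scalerA -scalerDl scalerA (mulrC _ q) -qnumS.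
by rewrite mulVf ?scale1r ?qnum_neq0.
Qed.

End Symmetrizer.

Fixpoint hecke_chain (T : nat -> R) (i g : nat) : R :=
  if g is g'.+1 then hecke_chain T i g' * T (i + g')%N else 1.

Lemma hecke_chain_recl T i g :
  hecke_chain T i g.+1 = T i * hecke_chain T i.+1 g.
Proof.
elim: g => [|g IH]; first by rewrite /= addn0 mul1r mulr1.
by rewrite -[LHS]/(hecke_chain T i g.+1 * _) IH /= mulrA addnS.
Qed.

Lemma hecke_chain_comm T i g x :
  (forall j, (i <= j < i + g)%N -> T j * x = x * T j) ->
  hecke_chain T i g * x = x * hecke_chain T i g.
Proof.
elim: g => [|g IH] Tx /=; first by rewrite mul1r mulr1.
have Cx : hecke_chain T i g * x = x * hecke_chain T i g.
  by apply: IH => j hj; apply: Tx; lia.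
by rewrite -mulrA Tx ?mulrA ?Cx //; lia.
Qed.

End HeckeAlgebra.

(** * The full twist *)

Section FullTwist.
Variables (K : numFieldType) (R : algType K).
Variables (q : K) (T : nat -> R) (k : nat).
Hypotheses (q_gt0 : 0 < q) (TH : hecke_family q T k).
Local Notation sym := (hecke_sym q T).
Local Notation chain := (hecke_chain T).

Fixpoint jucys_murphy (j : nat) : R :=
  if j is j'.+1 then T j' * jucys_murphy j' * T j' else 1.

Lemma hecke_chain_shift g i : (g < k)%N -> (i.+1 < g)%N ->
  chain 0 g * T i = T i.+1 * chain 0 g.
Proof.
case: TH => hq hb hc.
elim: g => [//|g IH] gk ig /=; rewrite add0n.
have [ig'|->] : (i.+1 < g)%N \/ g = i.+1 by lia.
  by rewrite -mulrA -hc ?mulrA ?IH //; lia.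
rewrite /= add0n -!mulrA (mulrA (T i)) hb; last by lia.
rewrite !mulrA hecke_chain_comm ?mulrA // => j hj; rewrite hc //; lia.
Qed.

Lemma hecke_chain_shiftn g i m : (g < k)%N -> (i + m < g)%N ->
  chain 0 g ^+ m * T i = T (i + m)%N * chain 0 g ^+ m.
Proof.
move=> gk; elim: m => [|m IH] im; first by rewrite !expr0 addn0 mul1r mulr1.
rewrite exprS -mulrA IH; last by lia.
by rewrite mulrA hecke_chain_shift ?addnS -?mulrA //; lia.
Qed.

Fixpoint hecke_dchain (m i : nat) : R :=
  if i is i'.+1 then hecke_dchain m i' * T (m - i')%N else 1.

Lemma hecke_dchainS m i :
  hecke_dchain m i.+1 = hecke_dchain m i * T (m - i)%N.
Proof. by []. Qed.

Lemma hecke_chainS i g : chain i g.+1 = chain i g * T (i + g)%N.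
Proof. by []. Qed.

Lemma hecke_dchain_recl m i :
  hecke_dchain m.+1 i.+1 = T m.+1 * hecke_dchain m i.
Proof.
elim: i => [|i IH]; first by rewrite /= subn0 mul1r mulr1.
by rewrite hecke_dchainS IH mulrA subSS.
Qed.

Lemma jucys_murphyE g :
  jucys_murphy g.+1 = hecke_dchain g g.+1 * chain 0 g.+1.
Proof.
elim: g => [|g IH]; first by rewrite /= mulr1 !mul1r.
rewrite hecke_dchain_recl hecke_chainS -mulrA.
by rewrite (mulrA _ (chain _ _)) -IH /= !mulrA.
Qed.

Lemma hecke_dchain_chain g i : (g.+1 < k)%N -> (i <= g)%N ->
  hecke_dchain g i * chain 0 g.+1 = chain 0 g * hecke_dchain g i.+1.
Proof.
move=> gk; have shift j : (j <= g)%N ->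
    hecke_dchain g j * chain 0 g.+1 = chain 0 g.+1 * hecke_dchain g.-1 j.
  elim: j => [|j IH] jg; first by rewrite /= mul1r mulr1.
  rewrite !hecke_dchainS -mulrA.
  have -> : (g - j = (g.-1 - j).+1)%N by lia.
  rewrite -hecke_chain_shift; try lia.
  by rewrite mulrA IH -?mulrA //; lia.
move=> ig; rewrite shift //; case: g gk ig {shift} => [|g] gk ig.
  by move: ig; rewrite leqn0 => /eqP->; rewrite /= !(mulr1, mul1r).
by rewrite hecke_dchain_recl mulrA.
Qed.

(** The i-th power of the longer chain is the i-th power of the shorter one times the descending
    word T_g T_(g-1) ... of length i. At i = g + 1, that word times one more chain is the
    Jucys-Murphy element. *)
Lemma hecke_chain_pow g : (g.+1 < k)%N ->
  chain 0 g.+1 ^+ g.+2 = chain 0 g ^+ g.+1 * jucys_murphy g.+1.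
Proof.
move=> gk; have chain_pow i : (i <= g.+1)%N ->
    chain 0 g.+1 ^+ i = chain 0 g ^+ i * hecke_dchain g i.
  elim: i => [|i IH] ig; first by rewrite !expr0 mulr1.
  rewrite exprSr IH; last by lia.
  by rewrite -mulrA hecke_dchain_chain // mulrA -exprSr.
by rewrite exprSr chain_pow // jucys_murphyE mulrA.
Qed.

Lemma hecke_chain_shift_chain g j : (g < k)%N -> (j < g)%N ->
  chain 1 j * chain 0 g = chain 0 g * chain 0 j.
Proof.
move=> gk; elim: j => [|j IH] jg; first by rewrite /= mul1r mulr1.
rewrite !hecke_chainS mulrA -IH; last by lia.
by rewrite -!mulrA add0n add1n hecke_chain_shift.
Qed.

(** Passing a chain raises the index of a generator by one, and two chains carry the last generator
    to the first ([D2]). Hence T_i runs up to T_(k-2), over to T_0 and back to T_i in (k - 2 - i) +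
    2 + i = k chains. *)
Lemma full_twist_comm i : (i.+1 < k)%N ->
  chain 0 k.-1 ^+ k * T i = T i * chain 0 k.-1 ^+ k.
Proof.
move=> ik; have [g kE] : exists g, k = g.+2 by exists k.-2; lia.
have gk : (g.+1 < k)%N by lia.
rewrite [k.-1](_ : _ = g.+1); last by lia.
rewrite [X in _ ^+ X]kE; set D := chain 0 g.+1.
have D2 : D ^+ 2 * T g = T 0%N * D ^+ 2.
  have DD : D * D = chain 1 g * D * T g.
    by rewrite {2}/D hecke_chainS add0n mulrA -hecke_chain_shift_chain.
  by rewrite expr2 [in RHS]DD !mulrA -hecke_chain_recl.
have Dshift j m : (j + m < g.+1)%N -> D ^+ m * T j = T (j + m)%N * D ^+ m.
  by move=> jm; rewrite /D hecke_chain_shiftn.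
have -> : D ^+ g.+2 = D ^+ i * D ^+ 2 * D ^+ (g - i).
  by rewrite -!exprD; congr (_ ^+ _); lia.
move: D (D ^+ 2) D2 Dshift => D D' D2 Dshift.
rewrite -!mulrA Dshift; last by lia.
rewrite [(i + (g - i))%N](_ : _ = g); last by lia.
by rewrite (mulrA D') D2 !mulrA Dshift ?add0n //; lia.
Qed.

(** Meant for the first Jucys-Murphy element past the row of a hook: on a vector symmetric under the
    earlier generators it is a scalar up to a term that the next symmetrizer controls. *)
Lemma jucys_murphy_sym y m : (m.+1 < k)%N ->
  (forall j, (j < m)%N -> T j * y = q *: y) ->
  jucys_murphy m.+1 * y = q ^+ m.+1 *: y
    + ((q - 1) * q ^+ m * qnum q m.+1) *: (sym 0 m * T m * y).
Proof.
case: TH => hq hb hc.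
elim: m y => [|m IH] y mk Ty.
  rewrite /= mulr1 mul1r hq // mulrDl -!scalerAl mul1r addrC qnum1.
  by rewrite expr1 expr0 !mulr1.
have ey : sym 0 m * y = y.
  by apply: (hecke_sym_absorbl q_gt0) => j hj; apply: Ty; lia.
have sT : sym 0 m * T m.+1 = T m.+1 * sym 0 m.
  by apply: hecke_sym_comm => j hj; apply: hc; lia.
rewrite -[jucys_murphy m.+2]/(T m.+1 * jucys_murphy m.+1 * T m.+1).
rewrite -mulrA -mulrA IH; first last.
- move=> j jm; rewrite mulrA. rewrite hc; [|lia|lia]. rewrite -mulrA Ty; last by lia. by rewrite -scalerAr.
- by lia.
set c := _ * qnum q m.+1.
have ssy : T m.+1 * (T m.+1 * y) = (q - 1) *: (T m.+1 * y) + q *: y.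
  by rewrite mulrA hq // mulrDl -!scalerAl mul1r.
have sEtsy : T m.+1 * (sym 0 m * T m * (T m.+1 * y))
    = q *: (sym 0 m * (T m * (T m.+1 * y))).
  rewrite -(mulrA (sym 0 m)) mulrA -sT -mulrA scalerAr; congr (_ * _).
  by rewrite !mulrA -hb // -!mulrA Ty // -!scalerAr.
have -> : sym 0 m.+1 * T m.+1 * y = (qnum q m.+2)^-1 *:
    (T m.+1 * y + qnum q m.+1 *: (sym 0 m * (T m * (T m.+1 * y)))).
  rewrite /= add0n -!scalerAl !mulrDl -!scalerAl; congr (_ *: (_ + _ *: _)).
    by rewrite sT -mulrA ey.
  by rewrite -!mulrA (mulrA (sym 0 m) (T m.+1)) sT -(mulrA (T m.+1)) ey.
move: (sym 0 m * (T m * _)) sEtsy => w sEtsy.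
rewrite mulrDr -!scalerAr ssy sEtsy !scalerDr !scalerA addrAC addrC addrA.
have qn0 := qnum_neq0 m.+1 q_gt0.
rewrite -addrA [_ *: y + _]addrC -!addrA [RHS]addrC -!addrA.
by congr (_ *: _ + (_ *: _ + _ *: _)); rewrite /c ?exprS; [field|field|ring].
Qed.

Fixpoint jm_prod (g : nat) : R :=
  if g is g'.+1 then jm_prod g' * jucys_murphy g else 1.

Lemma full_twist_jm g : (g < k)%N -> chain 0 g ^+ g.+1 = jm_prod g.
Proof.
elim: g => [|g IH] gk; first by rewrite expr1n.
by rewrite hecke_chain_pow // IH //; lia.
Qed.

(* The content formula for the hook with arm a: the Jucys-Murphy elements act
   by q^(2j) along the first row and by q^a down the first column. *)
Lemma full_twist_hook x a : (a < k)%N ->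
  (forall j, (j < a)%N -> T j * x = q *: x) ->
  (forall j, (a < j)%N -> (j.+1 < k)%N -> T j * x = - x) ->
  ((a.+1 < k)%N -> sym 0 a.+1 * x = 0) ->
  chain 0 k.-1 ^+ k * x = q ^+ (a * k) *: x.
Proof.
move=> ak Trow Tcol ex0.
have JMrow j : (j <= a)%N -> jucys_murphy j * x = q ^+ (2 * j) *: x.
  elim: j => [|j IH] ja; first by rewrite /= mul1r scale1r.
  rewrite /= -!mulrA Trow // -!scalerAr IH; last by lia.
  rewrite -scalerAr Trow // !scalerA; congr (_ *: _).
  by rewrite mulnS !exprS; ring.
have JMcol j : (a < j)%N -> (j < k)%N -> jucys_murphy j * x = q ^+ a *: x.
  elim: j => [//|j IH] aj jk; have [->|{}aj] : j = a \/ (a < j)%N by lia.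
    rewrite jucys_murphy_sym //; last by lia.
    have ex : sym 0 a * x = x.
      by apply: (hecke_sym_absorbl q_gt0) => l hl; apply: Trow; lia.
    (* The vanishing of the next symmetrizer says [a+1] sym T_a x = - x, so the Jucys-Murphy element
       acts by q^(a+1) - (q - 1) q^a = q^a. *)
    have := ex0 ltac:(lia).
    rewrite /= -scalerAl mulrDl add0n -scalerAl -(mulrA _ (sym 0 a) x) ex.
    move/eqP; rewrite scaler_eq0 invr_eq0 (negPf (qnum_neq0 _ q_gt0)) /=.
    rewrite addrC addr_eq0 => /eqP e1.
    rewrite -scalerA e1 scalerN -scalerBl; congr (_ *: _).
    by rewrite exprS; ring.
  rewrite /= -!mulrA Tcol // mulrN IH //; last by lia.
  by rewrite mulrN -scalerAr Tcol // scalerN opprK.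
have -> : k = k.-1.+1 by lia.
rewrite full_twist_jm; last by lia.
(* The exponents 2 + 4 + ... + 2g add up to g (g + 1) along the row; afterwards each factor
   contributes a. At g = k - 1 both cases give a k. *)
have jmE g : (g < k)%N ->
   jm_prod g * x = q ^+ (if (g <= a)%N then g * g.+1 else a * g.+1) *: x.
  elim: g => [|g IH] gk; first by rewrite /= mul1r scale1r.
  rewrite -[jm_prod _]/(jm_prod g * jucys_murphy g.+1) -mulrA.
  have [ga|ag] := leqP g.+1 a.
    rewrite JMrow // -scalerAr IH; last by lia.
    by rewrite (ltnW ga) scalerA -exprD; congr (_ ^+ _ *: _); lia.
  rewrite JMcol // -scalerAr IH; last by lia.
  by rewrite scalerA -exprD; congr (_ ^+ _ *: _); case: ifP; nia.
rewrite jmE; last by lia.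
by congr (_ ^+ _ *: _); case: ifP; nia.
Qed.

Local Notation asym := (hecke_sym q^-1 (hecke_dual q T)).

Lemma full_twist_sym_asym a : (a < k)%N ->
  chain 0 k.-1 ^+ k * (sym 0 a * asym a (k.-1 - a)) =
  q ^+ (a * k) *: (sym 0 a * asym a (k.-1 - a)).
Proof.
have qn0 : q != 0 by rewrite gt_eqF.
have qV0 : 0 < q^-1 by rewrite invr_gt0.
have TH' := hecke_family_dual qn0 TH.
case: (TH) => hq hb hc ak.
have Tas j : (a <= j)%N -> (j.+1 < k)%N ->
    T j * asym a (k.-1 - a) = - asym a (k.-1 - a).
  move=> aj jk; have := @hecke_sym_mull _ _ _ _ _ qV0 TH' a (k.-1 - a) j.
  move=> /(_ ltac:(lia) ltac:(lia)); rewrite {1}/hecke_dual -scalerAl.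
  rewrite scaleNr -scalerN => /(scalerI (lt0r_neq0 qV0)) e.
  by rewrite -[in RHS]e opprK.
apply: full_twist_hook => // [j ja|j aj jk|ak'].
- by rewrite mulrA (hecke_sym_mull q_gt0 TH) ?scalerAl //; lia.
- have C : sym 0 a * T j = T j * sym 0 a.
    by apply: hecke_sym_comm => l hl; apply: hc; lia.
  rewrite mulrA -C.
  by rewrite -mulrA Tas ?mulrN //; lia.
rewrite mulrA (hecke_sym_absorbr q_gt0); last first.
  by move=> j hj; apply: (hecke_sym_mulr q_gt0 TH); lia.
(* T_a belongs to both blocks: it acts by q on the left factor and by -1 on the right one, and q + 1
   is nonzero, so the product vanishes. *)
have : sym 0 a.+1 * T a * asym a (k.-1 - a) =
       sym 0 a.+1 * (T a * asym a (k.-1 - a)) by rewrite mulrA.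
rewrite (hecke_sym_mulr q_gt0 TH); try lia.
rewrite Tas // mulrN -scalerAl => /eqP; rewrite -subr_eq0 opprK.
rewrite -[X in _ + X]scale1r -scalerDl scaler_eq0 => /orP[|/eqP//].
by rewrite gt_eqF // addr_gt0.
Qed.

End FullTwist.

(** * Traces on the Hecke algebra *)

Section Traces.
Variables (K : numFieldType) (R : algType K).

(** Traciality is asked against the generators on k strands only. It therefore survives when a trace
    is twisted by an element commuting with these generators, such as a chain on later strands or a
    power of the full twist. *)
Definition trace_on (T : nat -> R) (k : nat) (theta : R -> K) : Prop :=
  [/\ forall x y, theta (x + y) = theta x + theta y,
      forall a x, theta (a *: x) = a * theta x
    & forall x j, (j.+1 < k)%N -> theta (x * T j) = theta (T j * x)].

Lemma trace_on_sym q T k theta x i g : trace_on T k theta -> (i + g < k)%N ->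
  theta (x * hecke_sym q T i g) = theta (hecke_sym q T i g * x).
Proof.
case=> tD tZ tT; elim: g x => [|g IH] x ik; first by rewrite /= mul1r mulr1.
have {}IH y := IH y (ltac:(lia) : (i + g < k)%N).
rewrite /= -scalerAr -scalerAl !tZ mulrDr mulrDl !tD -scalerAr -scalerAl !tZ.
congr (_ * (_ + _ * _)); first exact: IH.
rewrite !mulrA IH !mulrA tT; last by lia.
by rewrite !mulrA IH !mulrA.
Qed.

Lemma trace_on_dual q T k theta :
  trace_on T k theta -> trace_on (hecke_dual q T) k theta.
Proof.
case=> tD tZ tT; split=> // x j jk.
by rewrite /hecke_dual -scalerAr -scalerAl !tZ tT.
Qed.

Section Hooks.
Variables (q : K) (T : nat -> R).
Hypothesis q_gt0 : 0 < q.
Local Notation sym := (hecke_sym q T).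
Local Notation asym := (hecke_sym q^-1 (hecke_dual q T)).
Local Notation chain := (hecke_chain T).

(* Symmetrize the first a of k strands, antisymmetrize the others; one strand
   needs no generator, whence the predecessors. *)
Definition sym_asym (k a : nat) : R := sym 0 a.-1 * asym a (k - a).-1.

(* As sym_asym k a.+1, but the a-th strand lies in both blocks. *)
Definition hook_elt (k a : nat) : R := sym 0 a * asym a (k.-1 - a).

(** The factor is the q-analogue of (a+1)(k-a)/k, which turns the product of the normalized row and
    column symmetrizers of a hook into an idempotent. *)
Definition hook_trace (theta : R -> K) (k a : nat) : K :=
  qnum q a.+1 * qnum q (k - a) / qnum q k * theta (hook_elt k a).

Let q_neq0 : q != 0. Proof. by rewrite gt_eqF. Qed.
Let qV_gt0 : 0 < q^-1. Proof. by rewrite invr_gt0. Qed.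

Lemma sym_asym_comm k a i g : hecke_family q T k ->
  (i + g < k)%N -> (a < i)%N -> sym 0 a * asym i g = asym i g * sym 0 a.
Proof.
move=> TH ik ai; apply: hecke_sym_comm => j hj; symmetry.
apply: hecke_sym_comm => l hl; rewrite /hecke_dual -scalerAl -scalerAr.
by rewrite (hecke_comm TH (i := j)) //; lia.
Qed.

(* Expand the first block of the hook element a, resp. the second block of the
   hook element a-1: the cross terms cancel. *)
Lemma trace_sym_asym theta k a : (0 < k)%N -> (a <= k)%N ->
  hecke_family q T k -> trace_on T k theta ->
  theta (sym_asym k a) = (if (a < k)%N then hook_trace theta k a else 0)
    + (if (0 < a)%N then hook_trace theta k a.-1 else 0).
Proof.
move=> k0 ak TH tr; have TH' := hecke_family_dual q_neq0 TH.
have tr' := trace_on_dual q tr; have [tD tZ tT] := tr.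
have qk : qnum q k != 0 by case: k k0 {ak TH tr TH' tr' tT} => // k _; exact: qnum_neq0.
rewrite /hook_trace /hook_elt /sym_asym.
case: a ak => [|a] ak.
  by rewrite k0 /= addr0 !subn0 qnum1 !mul1r divff // mul1r.
rewrite ltn0Sn [a.+1.-1]/=; case: ltnP => [ak'|ka]; last first.
  have -> : a.+1 = k by lia.
  rewrite add0r subnn; have -> : (k - a = 1)%N by lia.
  have -> : (k.-1 - a = 0)%N by lia.
  by rewrite qnum1 mulr1 divff // mul1r.
have -> : (k.-1 - a = (k.-1 - a.+1).+1)%N by lia.
have -> : (k - a.+1).-1 = (k.-1 - a.+1)%N by lia.
have -> : (k - a = (k.-1 - a.+1).+2)%N by lia.
have -> : (k - a.+1 = (k.-1 - a.+1).+1)%N by lia.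
have kE : (k = a.+1 + (k.-1 - a.+1).+1)%N by lia.
move: (k.-1 - a.+1)%N kE => b kE.
have -> : sym 0 a.+1 = (qnum q a.+2)^-1 *:
    (sym 0 a + qnum q a.+1 *: (sym 0 a * T a * sym 0 a)) by [].
rewrite (hecke_sym_recl qV_gt0 TH'); last by lia.
have es : sym 0 a * sym 0 a = sym 0 a.
  by apply: (hecke_sym_idem q_gt0 TH); lia.
have ea : asym a.+1 b * asym a.+1 b = asym a.+1 b.
  by apply: (hecke_sym_idem qV_gt0 TH'); lia.
have C : sym 0 a * asym a.+1 b = asym a.+1 b * sym 0 a.
  by apply: (sym_asym_comm TH); lia.
have trs x : theta (x * sym 0 a) = theta (sym 0 a * x).
  by apply: (trace_on_sym _ _ tr); lia.
have tra x : theta (x * asym a.+1 b) = theta (asym a.+1 b * x).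
  by apply: (trace_on_sym _ _ tr'); lia.
rewrite -scalerAl -scalerAr !tZ mulrDl mulrDr !tD -scalerAl -scalerAr !tZ.
have -> : theta (sym 0 a * T a * sym 0 a * asym a.+1 b)
    = theta (T a * sym 0 a * asym a.+1 b).
  rewrite -mulrA C mulrA trs !mulrA es tra !mulrA -C tT ?mulrA //; lia.
have -> : theta (sym 0 a * (asym a.+1 b * hecke_dual q T a * asym a.+1 b))
    = - q^-1 * theta (T a * sym 0 a * asym a.+1 b).
  rewrite !mulrA tra !mulrA -C -(mulrA _ _ (asym _ _)) ea /hecke_dual.
  by rewrite -scalerAr tZ tT ?mulrA //; lia.
have -> : qnum q k = q ^+ b * qnum q^-1 b.+1 + q ^+ b.+1 * qnum q a.+1.
  by rewrite qnumV // -qnumD; congr qnum; lia.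
have := qnum_neq0 b.+1 qV_gt0; have := qnum_neq0 a.+1 q_gt0.
move: qk; rewrite (_ : k = b.+1 + a.+1)%N; last by lia.
rewrite qnumD -(qnumV b q_neq0) -(qnumV b.+1 q_neq0) exprS.
by move=> h1 h2 h3; field; rewrite q_neq0 h1 h2 h3.
Qed.

(** Analogue of the identity between complete and elementary symmetric functions, sum of (-1)^a h_a
    e_(k-a) = 0: each term is a sum of two neighbouring hooks, so the alternating sum telescopes. *)
Lemma alternating_sym_asym theta k : (0 < k)%N ->
  hecke_family q T k -> trace_on T k theta ->
  \sum_(a < k.+1) (-1) ^+ a * theta (sym_asym k a) = 0.
Proof.
move=> k0 TH tr.
pose h a : K := if (a < k)%N then (-1) ^+ a * hook_trace theta k a else 0.
rewrite (eq_bigr (fun a : 'I_k.+1 => h a - (if (0 < a)%N then h a.-1 else 0)));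
  last first.
  move=> a _; rewrite trace_sym_asym ?leq_ord // mulrDr /h.
  have ak := ltn_ord a; congr (_ + _); first by case: ifP; rewrite ?mulr0.
  case: (nat_of_ord a) ak => [|b] bk /=; first by rewrite mulr0 oppr0.
  by rewrite ifT // exprS; ring.
rewrite sumrB [X in X - _]big_ord_recr [X in _ - X]big_ord_recl /=.
by rewrite /h ltnn addr0 add0r subrr.
Qed.

Lemma sum_triangle (F : nat -> nat -> K) k :
  \sum_(a < k) \sum_(b < k - a) F a b = \sum_(s < k) \sum_(a < s.+1) F a (s - a)%N.
Proof.
elim: k => [|k IH]; first by rewrite !big_ord0.
rewrite [RHS]big_ord_recr /= -IH [in RHS]big_ord_recr /= addrA -big_split /=.
rewrite big_ord_recr /= subSn // subnn big_ord1; congr (_ + _).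
by apply: eq_bigr => a _; rewrite subSn 1?ltnW // big_ord_recr.
Qed.

(** A q-analogue of Newton's identities, the chain playing the power sum. The sum of q^a (-q)^b U a
    b over a + b < k is evaluated twice: on each diagonal a + b = s > 0 it vanishes by
    [alternating_sym_asym], leaving U 0 0, and on each row it telescopes. *)
Lemma newton_chain theta k : (0 < k)%N ->
  hecke_family q T k -> trace_on T k theta ->
  theta (chain 0 k.-1) =
    \sum_(a < k) (-1) ^+ (k - a).-1 * q ^+ a * qnum q (k - a)
       * theta (sym_asym k a).
Proof.
move=> k0 TH tr; have TH' := hecke_family_dual q_neq0 TH.
have tr' := trace_on_dual q tr; have [tD tZ tT] := tr.
(* In U the three factors occupy consecutive disjoint blocks of a, b and k - a - b strands. In E,
   for b > 0, the chain starts one strand earlier, on the last strand of the antisymmetrized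
   block. *)
pose U a b := theta (sym 0 a.-1 * asym a b.-1 * chain (a + b) (k - (a + b)).-1).
pose E a b := theta (sym 0 a.-1 * asym a b.-1 * chain (a + b).-1 (k - (a + b))).
have UE a b : (a + b < k)%N -> qnum q^-1 b.+1 * E a b.+1 =
    U a b - q^-1 * qnum q^-1 b * E a b.
  move=> abk; rewrite /E /U /= addnS /=.
  have -> : (k - (a + b).+1)%N = (k - (a + b)).-1 by lia.
  case: b abk => [|b] abk.
    by rewrite qnum0 qnum1 mulr0 mul0r subr0 mul1r.
  have -> : asym a b.+1 = (qnum q^-1 b.+2)^-1 *: (asym a b + qnum q^-1 b.+1 *:
     (asym a b * hecke_dual q T (a + b)%N * asym a b)) by [].
  set c := chain _ _.
  have cE : chain (a + b.+1).-1 (k - (a + b.+1)) = T (a + b)%N * c.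
    have -> : (k - (a + b.+1) = (k - (a + b.+1)).-1.+1)%N by lia.
    by rewrite hecke_chain_recl /c !addnS.
  have fc : asym a b * c = c * asym a b.
    apply: hecke_sym_comm => j hj; rewrite /hecke_dual -scalerAl -scalerAr.
    congr (_ *: _); symmetry; apply: hecke_chain_comm => l hl; symmetry.
    by apply: (hecke_comm TH); lia.
  have ff : asym a b * asym a b = asym a b.
    by apply: (hecke_sym_idem qV_gt0 TH'); lia.
  have ef : sym 0 a.-1 * asym a b = asym a b * sym 0 a.-1.
    case: a {cE c fc ff} abk => [|a] abk; first by rewrite /= mul1r mulr1.
    by apply: (sym_asym_comm TH); lia.
  have ta x : theta (x * asym a b) = theta (asym a b * x).
    by apply: (trace_on_sym _ _ tr'); lia.
  rewrite -scalerAr -scalerAl tZ mulVKf ?qnum_neq0 // mulrDr mulrDl tD.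
  rewrite -scalerAr -scalerAl tZ cE /=; congr (_ + _).
  rewrite !mulrA -(mulrA _ (asym a b) c) fc mulrA ta !mulrA -ef -(mulrA (sym _ _)) ff.
  by rewrite /hecke_dual -!scalerAr -scalerAl tZ; ring.
have Usum a : (a < k)%N -> \sum_(b < k - a) (- q) ^+ b * U a b =
    - q^-1 * (- q) ^+ (k - a) * qnum q^-1 (k - a) * theta (sym_asym k a).
  move=> ak; pose g b := - q^-1 * (- q) ^+ b * qnum q^-1 b * E a b.
  have -> : theta (sym_asym k a) = E a (k - a)%N.
    by rewrite /E /sym_asym subnKC 1?ltnW // subnn /= mulr1.
  rewrite -/(g (k - a)%N) (eq_bigr (fun b : 'I__ => g b.+1 - g b)); last first.
    move=> b _; have := UE a b ltac:(have := ltn_ord b; lia).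
    rewrite /g => e; rewrite -!mulrA e exprS.
    by field.
  rewrite -(big_mkord predT (fun b => g b.+1 - g b)) telescope_sumr //.
  by rewrite {2}/g qnum0 mulr0 mul0r subr0.
(* The chain w commutes with the generators on the first s strands, so theta(x w) is a trace in x
   there and the alternating identity applies with s strands. *)
have Udiag s : (0 < s < k)%N -> \sum_(a < s.+1) (-1) ^+ a * U a (s - a)%N = 0.
  move=> sk; pose w := chain s (k - s).-1.
  have TwC j : (j.+1 < s)%N -> w * T j = T j * w.
    move=> js; apply: hecke_chain_comm => l hl; symmetry.
    by apply: (hecke_comm TH); lia.
  pose theta' x := theta (x * w).
  have tr'' : trace_on T s theta'.
    split=> [x y|a x|x j js]; rewrite /theta'.
    - by rewrite mulrDl tD.
    - by rewrite -scalerAl tZ.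
    - by rewrite -mulrA -TwC // mulrA tT ?mulrA //; lia.
  have THs : hecke_family q T s by apply: hecke_family_le TH; lia.
  rewrite -[RHS](@alternating_sym_asym theta' s) //; last by lia.
  apply: eq_bigr => a _; rewrite /U /theta' /sym_asym subnKC //.
  exact: leq_ord.
have -> : theta (chain 0 k.-1) = U 0 0.
  by rewrite /U /= !mul1r subn0.
have -> : U 0 0 = \sum_(s < k) q ^+ s * ((-1) ^+ s *
    \sum_(a < s.+1) (-1) ^+ a * U a (s - a)%N).
  rewrite -[k](prednK k0) big_ord_recl big_ord1 !expr0 !mul1r big1 ?addr0 //.
  move=> s _; rewrite lift0 Udiag ?mulr0 //.
  by have := ltn_ord s; lia.
transitivity (\sum_(a < k) q ^+ a * \sum_(b < k - a) (- q) ^+ b * U a b).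
  under [RHS]eq_bigr do rewrite mulr_sumr.
  rewrite (sum_triangle (fun a b => q ^+ a * ((- q) ^+ b * U a b))).
  apply: eq_bigr => s _; rewrite !mulr_sumr; apply: eq_bigr => a _.
  move: (leq_ord a); rewrite (exprNn q) !mulrA => a_le; congr (_ * _).
  move: (nat_of_ord a) a_le => i; move: (nat_of_ord s) => j ij.
  rewrite -{1 2}(subnKC ij) !exprD -signr_odd -(signr_odd _ (j - i)).
  by case: (odd i); case: (odd _); rewrite ?expr1 ?expr0; ring.
apply: eq_bigr => a _; rewrite Usum //; have ak := ltn_ord a.
rewrite mulrA; congr (_ * _); have -> : (k - a = (k - a).-1.+1)%N by lia.
rewrite -(qnumV _ q_neq0) /= !exprS (exprNn q).
by field.
Qed.

(** Summation by parts: the coefficients of two neighbouring products combine by [k-a] - q [k-a-1] =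
    1. The outcome is the Murnaghan-Nakayama rule for a Coxeter element, with value (-1)^(k-1-a) q^a
    on the hook with arm a. *)
Lemma trace_chain theta k : (0 < k)%N ->
  hecke_family q T k -> trace_on T k theta ->
  theta (chain 0 k.-1) = \sum_(a < k) (-1) ^+ (k - a).-1 * q ^+ a
     * hook_trace theta k a.
Proof.
move=> k0 TH tr; rewrite newton_chain //.
pose c a : K := (-1) ^+ (k - a).-1 * q ^+ a * qnum q (k - a).
rewrite (eq_bigr (fun a : 'I_k => c a * hook_trace theta k a
     + c a * (if (0 < a)%N then hook_trace theta k a.-1 else 0))); last first.
  move=> a _; rewrite (trace_sym_asym k0 (ltnW (ltn_ord a)) TH tr).
  by rewrite (ltn_ord a) mulrDr.
case: k k0 {TH tr} @c => // g _ c.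
rewrite big_split /= [X in _ + X]big_ord_recl /= mulr0 add0r.
rewrite big_ord_recr [RHS]big_ord_recr /= addrAC -big_split /=; congr (_ + _).
  apply: eq_bigr => a _; rewrite -mulrDl; congr (_ * _).
  have ag := ltn_ord a; rewrite /c /bump leq0n add1n subSS.
  have -> : (g.+1 - a = (g - a).-1.+2)%N by lia.
  have -> : (g - a = (g - a).-1.+1)%N by lia.
  by rewrite /= (qnumS _ _.+1) !exprS; ring.
by rewrite /c subSnn qnum1 mulr1.
Qed.

(* Multiplying the trace by powers of the central full twist separates the
   hooks, on which it acts by distinct scalars. *)
Lemma trace_chain_pow tau k m : (0 < k)%N ->
  hecke_family q T k -> (forall x y, tau (x * y) = tau (y * x)) ->
  trace_on T k tau ->
  tau (chain 0 k.-1 ^+ (1 + k * m)) =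
  \sum_(a < k) (-1) ^+ (k - a).-1 * hook_trace tau k a * (q ^+ a) ^+ (1 + k * m).
Proof.
move=> k0 TH tauC [tD tZ tT]; set z := chain 0 k.-1 ^+ k.
have zC j n : (j.+1 < k)%N -> z ^+ n * T j = T j * z ^+ n.
  move=> jk; elim: n => [|n IH]; first by rewrite mul1r mulr1.
  rewrite exprS -mulrA IH mulrA [z * _](full_twist_comm q_gt0 TH) //.
  by rewrite -mulrA.
pose theta x := tau (z ^+ m * x).
have tr : trace_on T k theta.
  split=> [x y|a x|x j jk]; rewrite /theta.
  - by rewrite mulrDr tD.
  - by rewrite -scalerAr tZ.
  - by rewrite !mulrA tauC mulrA -zC.
have -> : tau (chain 0 k.-1 ^+ (1 + k * m)) = theta (chain 0 k.-1).
  by rewrite /theta /z -exprM addnC exprD expr1.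
rewrite trace_chain //; apply: eq_bigr => a _.
have zH : z ^+ m * hook_elt k a = q ^+ (a * k * m) *: hook_elt k a.
  elim: m {theta tr} => [|m IH]; first by rewrite muln0 !expr0 mul1r scale1r.
  rewrite exprS -mulrA IH -scalerAr (full_twist_sym_asym q_gt0 TH) //.
  by rewrite scalerA -exprD; congr (_ ^+ _ *: _); lia.
rewrite /hook_trace /theta zH tZ -exprM mulnDr muln1 exprD mulnA.
by ring.
Qed.

Lemma hook_trace_rec theta k a : (a < k)%N ->
  hecke_family q T k -> trace_on T k theta ->
  hook_trace theta k a = \sum_(b < a.+1) (-1) ^+ (a - b) * theta (sym_asym k b).
Proof.
move=> ak TH tr; elim: a ak => [|a IH] ak.
  by rewrite big_ord1 expr0 mul1r trace_sym_asym // ak addr0.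
rewrite big_ord_recr /= subnn mul1r trace_sym_asym ?(ltnW ak) //; last by lia.
rewrite ak /= IH; last by lia.
under [in RHS]eq_bigr => b _ do rewrite subSn ?leq_ord // exprS mulN1r mulNr.
by rewrite sumrN addrC addrK.
Qed.

End Hooks.

(** [S j] abstracts the elements that avoid T_j, and [tS] makes T_j orthogonal to them. By cyclicity
    the cross term e T_j e of the recursion has trace zero against y, so each step only divides by a
    q-number. *)
Lemma trace_hecke_sym (q : K) (T : nat -> R) (tau : R -> K)
    (S : nat -> R -> Prop) i g (y : R) :
  0 < q ->
  (forall j x z, S j x -> S j z -> S j (x + z)) ->
  (forall j x z, S j x -> S j z -> S j (x * z)) ->
  (forall j a x, S j x -> S j (a *: x)) ->
  (forall j, S j 1) ->
  (forall j l, (i <= j < i + g)%N -> (i <= l < i + g)%N -> l != j -> S j (T l)) ->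
  (forall x z, tau (x + z) = tau x + tau z) ->
  (forall a x, tau (a *: x) = a * tau x) ->
  (forall x z, tau (x * z) = tau (z * x)) ->
  (forall j x, (i <= j < i + g)%N -> S j x -> tau (x * T j) = 0) ->
  (forall j, (i <= j < i + g)%N -> S j y) ->
  tau (hecke_sym q T i g * y) = tau y / qfact q g.+1.
Proof.
move=> q0 SD SM SZ S1 ST tD tZ tC tS.
have symS j h : (i <= j < i + g)%N -> (i + h <= j)%N ->
    S j (hecke_sym q T i h).
  move=> hj; elim: h => [|h IH] ih; first exact: S1.
  have eS := IH ltac:(lia).
  apply/SZ/SD/SZ/SM => //; apply: SM => //; apply: ST => //; first by lia.
  by apply/eqP; lia.
elim: g ST tS symS => [|g IH] ST tS symS yS.
  by rewrite mul1r /qfact big_ord1 qnum1 divr1.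
rewrite /= -scalerAl tZ mulrDl tD -scalerAl tZ.
rewrite -(mulrA _ _ y) (tC (_ * _)) mulrA tS ?mulr0 ?addr0; first last.
- have ig : (i <= i + g < i + g.+1)%N by lia.
  by apply: (SM) => //; [apply: (SM) => //; [exact: symS|exact: yS]|exact: symS].
- by lia.
rewrite IH; first by rewrite [in RHS]qfactS; field; rewrite !qnum_neq0 ?qfact_neq0.
- by move=> j l hj hl; apply: ST; lia.
- by move=> j x hj; apply: tS; lia.
- by move=> j h hj; apply: symS; lia.
- by move=> j hj; apply: yS; lia.
Qed.

Lemma qfact_pred (q : K) a : qfact q a.-1.+1 = qfact q a.
Proof. by case: a => //; rewrite /qfact big_ord1 qnum1 big_ord0. Qed.

Lemma trace_sym_asym_eval (q : K) (T : nat -> R) (tau : R -> K)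
    (S : nat -> R -> Prop) k a :
  0 < q -> (a <= k)%N ->
  (forall j x z, S j x -> S j z -> S j (x + z)) ->
  (forall j x z, S j x -> S j z -> S j (x * z)) ->
  (forall j c x, S j x -> S j (c *: x)) ->
  (forall j, S j 1) ->
  (forall j l, (j.+1 < k)%N -> (l.+1 < k)%N -> l != j -> S j (T l)) ->
  (forall x z, tau (x + z) = tau x + tau z) ->
  (forall c x, tau (c *: x) = c * tau x) ->
  (forall x z, tau (x * z) = tau (z * x)) ->
  (forall j x, (j.+1 < k)%N -> S j x -> tau (x * T j) = 0) ->
  tau (sym_asym q T k a) = tau 1 / (qfact q a * qfact q^-1 (k - a)).
Proof.
move=> q0 ak SD SM SZ S1 ST tD tZ tC tS; rewrite /sym_asym.
have qV0 : 0 < q^-1 by rewrite invr_gt0.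
rewrite (trace_hecke_sym (S := S)) //; first last.
- move=> j hj; suff asymS h : (h <= (k - a).-1)%N ->
      S j (hecke_sym q^-1 (hecke_dual q T) a h) by exact: asymS.
  elim: h => [|h IH] hk; first exact: S1.
  have eS := IH ltac:(lia).
  have [h1 h2 h3] : [/\ (j.+1 < k)%N, ((a + h).+1 < k)%N & (a + h != j)%N].
    by split; [| |apply/eqP]; lia.
  by apply/SZ/SD/SZ/(SM) => //; apply: (SM) => //; apply/SZ/ST.
- by move=> j x hj; apply: tS; lia.
- by move=> j l hj hl; apply: ST; lia.
rewrite -[hecke_sym _ _ a _]mulr1 (trace_hecke_sym (S := S)) //; first last.
- by move=> j x hj xS; rewrite -scalerAr tZ tS ?mulr0 //; lia.
- by move=> j l hj hl jl; apply/SZ/ST => //; lia.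
by rewrite !qfact_pred; field; rewrite !qfact_neq0.
Qed.

End Traces.

(** * Galois action on power traces *)

(** The hypothesis extends linearly from powers to all polynomials; p is nonzero at v and vanishes
    at all other values of b. *)
Lemma sum_horner_eq0 (J : finType) (a b : J -> algC) :
  (forall m, \sum_j a j * b j ^+ m = 0) ->
  forall v, \sum_(j | b j == v) a j = 0.
Proof.
move=> ab0 v; pose p : {poly algC} := \prod_(j | b j != v) ('X - (b j)%:P).
have pv : p.[v] != 0.
  rewrite horner_prod; apply/prodf_neq0 => j bv.
  by rewrite hornerXsubC subr_eq0 eq_sym.
have pb j : b j != v -> p.[b j] = 0.
  move=> bv; rewrite horner_prod (bigD1 j) //= hornerXsubC subrr.
  by rewrite mul0r.
apply/eqP; rewrite -(mulIr_eq0 _ (mulIf pv)) mulr_suml.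
have <- : \sum_j a j * p.[b j] = \sum_(j | b j == v) a j * p.[v].
  rewrite (bigID (fun j => b j == v)) /= [X in _ + X]big1 ?addr0 => [|j bv].
    by apply: eq_bigr => j /eqP->.
  by rewrite pb // mulr0.
under eq_bigr do rewrite horner_coef mulr_sumr.
rewrite exchange_big big1 //= => i _.
by under eq_bigr do rewrite mulrCA; rewrite -mulr_sumr ab0 mulr0.
Qed.

(* The k-th powers separate the b_j up to k-th roots of unity, and the Galois
   group raises those to any power prime to k. *)
Lemma power_sum_galois (J : finType) (c b : J -> algC) (k n : nat) :
  (0 < k)%N -> (0 < n)%N -> coprime n k ->
  (forall j (u : {rmorphism algC -> algC}), u (c j) = c j) ->
  (forall m, \sum_j c j * b j ^+ (1 + k * m) = 0) ->
  \sum_j c j * b j ^+ n = 0.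
Proof.
move=> k0 n0 co cu cb0.
have cb v : \sum_(j | b j ^+ k == v) c j * b j = 0.
  apply: sum_horner_eq0 => m; rewrite -[RHS](cb0 m); apply: eq_bigr => j _.
  by rewrite exprD expr1 exprM mulrA.
have cbn v : \sum_(j | b j ^+ k == v) c j * b j ^+ n = 0.
  pose s := k.-root v; have sk : s ^+ k = v by rewrite rootCK.
  have [v0|v0] := eqVneq v 0.
    rewrite big1 // => j; rewrite v0 expf_eq0 k0 => /eqP->.
    by rewrite expr0n (gtn_eqF n0) mulr0.
  have s0 : s != 0 by apply: contra_neq v0 => s0; rewrite -sk s0 expr0n gtn_eqF.
  (* The automorphism u is only known on k-th roots of unity, hence the division by one fixed root s
     of v: every quotient b_j / s is such a root. *)
  have [u uP] := Qn_aut_exists co.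
  have : u (\sum_(j | b j ^+ k == v) c j * (b j / s)) = 0.
    by rewrite (eq_bigr _ (fun j _ => mulrA _ _ _)) -mulr_suml cb mul0r rmorph0.
  rewrite rmorph_sum /= => e.
  rewrite -[LHS](divfK (expf_neq0 n s0)) mulr_suml.
  suff -> : \sum_(j | b j ^+ k == v) c j * b j ^+ n / s ^+ n =
            \sum_(j | b j ^+ k == v) u (c j * (b j / s)) by rewrite e mul0r.
  apply: eq_bigr => j /eqP bj.
  rewrite rmorphM cu uP ?exprMn ?exprVn ?mulrA //.
  by rewrite bj -sk mulfV // expf_neq0.
pose vals := undup [seq b j ^+ k | j <- enum J].
have -> : \sum_j c j * b j ^+ n
    = \sum_(v <- vals) \sum_(j | b j ^+ k == v) c j * b j ^+ n.
  rewrite (exchange_big_dep predT) //=; apply: eq_bigr => j _.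
  rewrite big_mkcond (bigD1_seq (b j ^+ k)) ?undup_uniq //=; last first.
    by rewrite mem_undup; apply: map_f; rewrite mem_enum.
  rewrite eqxx big1 ?addr0 // => v bv.
  by rewrite eq_sym (negPf bv).
by rewrite big1.
Qed.

Lemma trig_mx_exp (C : comNzRingType) r (A : 'M[C]_r.+1) m : is_trig_mx A ->
  is_trig_mx (A ^+ m) /\ forall i, (A ^+ m) i i = A i i ^+ m.
Proof.
move=> /is_trig_mxP tA; elim: m => [|m [/is_trig_mxP tAm Am]].
  by rewrite expr0 scalar_mx_is_trig; split=> // i; rewrite mxE eqxx.
rewrite exprS; split=> [|i].
  apply/is_trig_mxP => i j ij; rewrite mxE big1 // => l _.
  have [il|li] := ltnP i l; first by rewrite tA ?mul0r.
  by rewrite tAm ?mulr0 //; apply: leq_ltn_trans ij.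
rewrite mxE (bigD1 i) //= big1 ?addr0 ?Am ?exprS // => l.
rewrite neq_ltn => /orP[li|il]; last by rewrite tA ?mul0r.
by rewrite tAm ?mulr0.
Qed.

Lemma trace_exp_eigen r (A : 'M[algC]_r.+1) :
  exists b : 'I_r.+1 -> algC, forall m, \tr (A ^+ m) = \sum_i b i ^+ m.
Proof.
have [P /unitarymx_unit uP] := Schur A (ltn0Sn r).
rewrite /similar_to conjumx // => tA; set B := P *m A *m invmx P in tA.
exists (fun i => B i i) => m; have [_ Bm] := trig_mx_exp m tA.
rewrite -(eq_bigr _ (fun i _ => Bm i)) -/(\tr (B ^+ m)).
have -> : B ^+ m = P *m (A ^+ m) *m invmx P.
  elim: m {Bm} => [|m IH]; first by rewrite !expr0 mulmx1 mulmxV.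
  rewrite !exprSr IH /B -!mulmxE !mulmxA -(mulmxA _ (invmx P) P) mulVmx //.
  by rewrite mulmx1.
by rewrite mxtrace_mulC mulmxA mulVmx // mul1mx.
Qed.

(** The eigenvalues with coefficient 1 and the x_b with coefficient - t_b form a single family,
    whose power sums vanish at all exponents 1 + k m. *)
Lemma trace_power_galois r (A : 'M[algC]_r.+1) k n (t x : nat -> algC) :
  (0 < k)%N -> (0 < n)%N -> coprime n k ->
  (forall b (u : {rmorphism algC -> algC}), (b < k)%N -> u (t b) = t b) ->
  (forall m, \tr (A ^+ (1 + k * m)) = \sum_(b < k) t b * x b ^+ (1 + k * m)) ->
  \tr (A ^+ n) = \sum_(b < k) t b * x b ^+ n.
Proof.
move=> k0 n0 co ut trA; have [al alP] := trace_exp_eigen A.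
pose c (j : 'I_r.+1 + 'I_k) : algC := if j is inr b then - t b else 1.
pose be (j : 'I_r.+1 + 'I_k) : algC :=
  match j with inl i => al i | inr b => x b end.
have sumE m : \sum_j c j * be j ^+ m = \tr (A ^+ m) - \sum_(b < k) t b * x b ^+ m.
  rewrite big_sumType /= alP -sumrN; congr (_ + _); apply: eq_bigr => i _.
    by rewrite mul1r.
  by rewrite mulNr.
apply/eqP; rewrite -subr_eq0 -sumE; apply/eqP.
apply: power_sum_galois co _ _ => // [[i|b] u|m] /=; first exact: rmorph1.
  by rewrite rmorphN ut.
by rewrite sumE trA subrr.
Qed.

(** * Functions on GL_k(F) and the Borel idempotent *)

Section GroupAlgebra.
Variables (K : numFieldType) (F : finFieldType) (d : nat).
Local Notation k := d.+1.
Local Notation q := (#|F|%:R : K).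

Definition GLmx : finType := {g : 'M[F]_k | g \in unitmx}.
Local Notation N := #|{: GLmx}|.

(* Right translation by x on the functions on GL_k(F); it vanishes when x is
   not invertible, and is therefore multiplicative on all matrices. *)
Definition translation (x : 'M[F]_k) : 'M[K]_N :=
  \matrix_(i, j) (val (enum_val i) *m x == val (enum_val j))%:R.

Lemma sum_enum_val (V : nmodType) (f : GLmx -> V) :
  \sum_(i < N) f (enum_val i) = \sum_g f g.
Proof.
rewrite (reindex (fun i : 'I_N => enum_val i)) //=.
by exists enum_rank => g _; rewrite ?enum_valK ?enum_rankK.
Qed.

Lemma translationM x y :
  translation x *m translation y = translation (x *m y).
Proof.
apply/matrixP => i j; rewrite !mxE.
under eq_bigr do rewrite !mxE.
rewrite (sum_enum_val (fun h : GLmx => (val (enum_val i) *m x == val h)%:R *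
  (val h *m y == val (enum_val j))%:R)).
set g := enum_val i; have ug := valP g.
have [ux|nux] := boolP (x \in unitmx).
  have ugx : val g *m x \in unitmx by rewrite unitmx_mul ug.
  rewrite (bigD1 (Sub (val g *m x) ugx : GLmx)) //= eqxx mul1r mulmxA big1 ?addr0 // => h hg.
  by rewrite eq_sym (_ : (_ == _) = false) ?mul0r //; apply/negbTE.
rewrite big1 => [|h _].
  case: eqP => // e; have := valP (enum_val j); rewrite -e !unitmx_mul.
  by rewrite (negPf nux) /= andbF.
case: eqP => [e|]; last by rewrite mul0r.
by have := valP h; rewrite -e unitmx_mul (negPf nux) andbF.
Qed.

Lemma translation1 : translation 1%:M = 1%:M.
Proof.
apply/matrixP => i j; rewrite !mxE mulmx1 (inj_eq val_inj).
by rewrite (inj_eq enum_val_inj).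
Qed.

Lemma trace_translation x :
  \tr (translation x) = if x == 1%:M then N%:R else 0.
Proof.
rewrite /mxtrace; have [->|x1] := eqVneq.
  by under eq_bigr do rewrite mxE mulmx1 eqxx; rewrite sumr_const card_ord.
rewrite big1 // => i _; rewrite mxE; case: eqP => // e.
case/negP: x1; apply/eqP; rewrite -[x](mulKmx (valP (enum_val i))) e mulVmx //.
exact: (valP (enum_val i)).
Qed.

Definition borel : {set 'M[F]_k} :=
  [set x : 'M[F]_k | (x \in unitmx) &&
    [forall i : 'I_k, forall j : 'I_k, (j < i)%N ==> (x i j == 0)]].

Lemma borelP x : reflect
  (x \in unitmx /\ forall i j : 'I_k, (j < i)%N -> x i j = 0) (x \in borel).
Proof.
rewrite inE; apply: (iffP andP) => -[ux bx]; split=> //.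
  by move=> i j ij; move/forallP/(_ i)/forallP/(_ j)/implyP: bx => /(_ ij)/eqP.
by apply/forallP => i; apply/forallP => j; apply/implyP => /bx->.
Qed.

Lemma borel1 : 1%:M \in borel.
Proof.
apply/borelP; split=> [|i j ij]; first exact: unitmx1.
by rewrite mxE; case: eqP => // e; rewrite e ltnn in ij.
Qed.

Lemma borelM x y : x \in borel -> y \in borel -> x *m y \in borel.
Proof.
move=> /borelP[ux bx] /borelP[uy by_]; apply/borelP; split=> [|i j ij].
  by rewrite unitmx_mul ux.
rewrite mxE big1 // => l _; have [li|il] := ltnP l i; first by rewrite bx ?mul0r.
by rewrite by_ ?mulr0 //; apply: leq_trans il.
Qed.

Lemma borel_unit x : x \in borel -> x \in unitmx.
Proof. by case/borelP. Qed.

Lemma borel_diag_neq0 x i : x \in borel -> x i i != 0.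
Proof.
move=> /borelP[ux bx]; move: ux; rewrite unitmxE -det_tr det_trig; last first.
  by apply/is_trig_mxP => a b ab; rewrite mxE bx.
by rewrite unitfE => /prodf_neq0/(_ i isT); rewrite mxE.
Qed.

Lemma submonoid_inv (S : {set 'M[F]_k}) x : 1%:M \in S ->
  {in S &, forall y z, y *m z \in S} -> x \in S -> x \in unitmx ->
  invmx x \in S.
Proof.
move=> S1 SM xS ux; have inj_x : {in S &, injective (mulmx x)}.
  by move=> y z _ _; apply: (can_inj (mulKmx ux)).
have : [set x *m y | y in S] == S.
  rewrite eqEcard card_in_imset // leqnn andbT.
  by apply/subsetP => _ /imsetP[y yS ->]; apply: SM.
move/eqP/setP/(_ 1%:M); rewrite S1 => /imsetP[y yS e].
by suff -> : invmx x = y by []; rewrite -[RHS](mulKmx ux) -e mulmx1.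
Qed.

Lemma borelV x : x \in borel -> invmx x \in borel.
Proof.
by move=> xB; apply: submonoid_inv => //; rewrite ?borel1 ?borel_unit //;
  exact: borelM.
Qed.

Definition average (S : {set 'M[F]_k}) : 'M[K]_N :=
  #|S|%:R^-1 *: \sum_(b in S) translation b.

Lemma averagel (S : {set 'M[F]_k}) x : x \in S -> x \in unitmx ->
  {in S &, forall y z, y *m z \in S} ->
  translation x *m average S = average S.
Proof.
move=> xS ux SM; rewrite /average -scalemxAr mulmx_sumr; congr (_ *: _).
under eq_bigr do rewrite translationM.
have inj_x : {in S &, injective (mulmx x)}.
  by move=> y z _ _; apply: (can_inj (mulKmx ux)).
rewrite -(big_imset translation inj_x); apply: eq_bigl => y.
suff -> : [set x *m y | y in S] = S by [].
apply/eqP; rewrite eqEcard card_in_imset // leqnn andbT.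
by apply/subsetP => _ /imsetP[z zS ->]; apply: SM.
Qed.

Lemma averager (S : {set 'M[F]_k}) x : x \in S -> x \in unitmx ->
  {in S &, forall y z, y *m z \in S} ->
  average S *m translation x = average S.
Proof.
move=> xS ux SM; rewrite /average -scalemxAl mulmx_suml; congr (_ *: _).
under eq_bigr do rewrite translationM.
have inj_x : {in S &, injective (mulmx^~ x)}.
  by move=> y z _ _; apply: (can_inj (mulmxK ux)).
rewrite -(big_imset translation inj_x); apply: eq_bigl => y.
suff -> : [set y *m x | y in S] = S by [].
apply/eqP; rewrite eqEcard card_in_imset // leqnn andbT.
by apply/subsetP => _ /imsetP[z zS ->]; apply: SM.
Qed.

Lemma average_const (S : {set 'M[F]_k}) (f : 'M[F]_k -> 'M[K]_N) (y : 'M[K]_N) :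
  S != set0 -> {in S, forall b, f b = y} ->
  #|S|%:R^-1 *: \sum_(b in S) f b = y.
Proof.
move=> S0 fy; rewrite (eq_bigr (fun=> y)) => [|b bS]; last exact: fy.
rewrite sumr_const -scaler_nat scalerA mulVf ?scale1r //.
by rewrite pnatr_eq0 cards_eq0.
Qed.

Lemma mulmx_averageE (S : {set 'M[F]_k}) (u v : 'M[K]_N) :
  u *m average S *m v =
  #|S|%:R^-1 *: \sum_(b in S) u *m translation b *m v.
Proof. by rewrite /average -scalemxAr -scalemxAl mulmx_sumr mulmx_suml. Qed.

Definition borel_idem : 'M[K]_N := average borel.
Local Notation e := borel_idem.

Lemma borel_idem_l b : b \in borel -> translation b *m e = e.
Proof. by move=> bB; apply: averagel => //; [exact: borel_unit|exact: borelM]. Qed.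

Lemma borel_idem_r b : b \in borel -> e *m translation b = e.
Proof. by move=> bB; apply: averager => //; [exact: borel_unit|exact: borelM]. Qed.

Lemma borel_neq0 : borel != set0.
Proof. by apply/set0Pn; exists 1%:M; apply: borel1. Qed.

Lemma borel_idemM : e *m e = e.
Proof.
rewrite {1}/borel_idem /average -scalemxAl mulmx_suml.
by apply: average_const borel_neq0 _ => b bB; rewrite borel_idem_l.
Qed.

Definition double_coset (x : 'M[F]_k) : 'M[K]_N := e *m translation x *m e.

Lemma double_cosetB b x b' : b \in borel -> b' \in borel ->
  double_coset (b *m x *m b') = double_coset x.
Proof.
move=> bB b'B; rewrite /double_coset -!translationM !mulmxA borel_idem_r //.
by rewrite -!mulmxA borel_idem_l.
Qed.

Lemma double_coset1 : double_coset 1%:M = e.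
Proof. by rewrite /double_coset translation1 mulmx1 borel_idemM. Qed.

Lemma double_cosetM x y : double_coset x *m double_coset y =
  #|borel|%:R^-1 *: \sum_(b in borel) double_coset (x *m b *m y).
Proof.
have -> : double_coset x *m double_coset y
    = e *m translation x *m average borel *m (translation y *m e).
  by rewrite /double_coset !mulmxA -(mulmxA _ e e) borel_idemM.
rewrite mulmx_averageE; congr (_ *: _).
by apply: eq_bigr => b _; rewrite /double_coset -!translationM !mulmxA.
Qed.

End GroupAlgebra.

(** * Simple reflections and Coxeter cycles in the symmetric group *)

Section CoxeterElements.
Variable d : nat.
Local Notation k := d.+1.

Definition simple_refl (i : nat) : 'S_k := tperm (inord i) (inord i.+1).
Local Notation s := simple_refl.

Lemma val_simple_refl i (x : 'I_k) : (i < d)%N ->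
  s i x = (if x == i :> nat then i.+1 else if x == i.+1 :> nat then i else x) :> nat.
Proof.
move=> id; have e0 : (inord i : 'I_k) = i :> nat by rewrite inordK; lia.
have e1 : (inord i.+1 : 'I_k) = i.+1 :> nat by rewrite inordK; lia.
rewrite /simple_refl; case: tpermP => [->|->|]; rewrite ?e0 ?e1 ?eqxx //.
  by case: eqP => //; lia.
by move=> /eqP + /eqP; rewrite -!val_eqE /= e0 e1 => /negPf-> /negPf->.
Qed.

Lemma simple_refl_l i : s i (inord i) = inord i.+1.
Proof. exact: tpermL. Qed.

Lemma simple_refl_r i : s i (inord i.+1) = inord i.
Proof. exact: tpermR. Qed.

Lemma simple_refl_fix i j : (i < d)%N -> (j < k)%N -> j != i -> j != i.+1 ->
  s i (inord j) = inord j.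
Proof.
move=> id jk ji ji1; apply: val_inj; rewrite /= val_simple_refl // inordK //.
by rewrite (negPf ji) (negPf ji1).
Qed.

Lemma inord_ltn i j : (i < j)%N -> (j < k)%N ->
  ((inord i : 'I_k) < (inord j : 'I_k))%N.
Proof. by move=> ij jk; rewrite !inordK //; lia. Qed.

Lemma simple_refl_conj i j :
  (s j * s i * s j)%g = tperm (s j (inord i)) (s j (inord i.+1)).
Proof. by rewrite -tpermJ conjgE tpermV mulgA. Qed.

Fixpoint coxeter (i g : nat) : 'S_k :=
  if g is g'.+1 then (s i * coxeter i.+1 g')%g else 1%g.

Lemma val_coxeter i g (x : 'I_k) : (i + g <= d)%N ->
  coxeter i g x = (if x == i :> nat then (i + g)%N
    else if (i < x <= i + g)%N then x.-1 else x) :> nat.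
Proof.
elim: g i x => [|g IH] i x ig /=.
  by rewrite perm1; case: eqP => [->|]; [lia|case: ifP => //; lia].
rewrite permM IH; last by lia.
rewrite val_simple_refl; last by lia.
move: (nat_of_ord x) => m; case: (m =P i) => [_|mi].
  by rewrite eqxx addSnnS.
case: (m =P i.+1) => [->|mi1].
  by rewrite (ltn_eqF (ltnSn i)) ltnNge leqnSn ltnSn /= ifT //; lia.
by rewrite ?(negPf (introN eqP mi1)); case: ifP; case: ifP => //; lia.
Qed.

Lemma val_coxeter_full (x : 'I_k) :
  coxeter 0 d x = (if x == 0 :> nat then d else x.-1) :> nat.
Proof.
rewrite val_coxeter // !add0n; case: eqP => // x0.
by rewrite ifT //; have := ltn_ord x; lia.
Qed.

End CoxeterElements.

(** * Hecke relations between Borel double cosets *)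

Section SimpleReflections.
Variables (K : numFieldType) (F : finFieldType) (d : nat).
Local Notation k := d.+1.
Local Notation q := (#|F|%:R : K).
Local Notation e := (borel_idem K F d).
Local Notation borel := (borel F d).

Definition transvection (t : F) (i j : 'I_k) : 'M[F]_k :=
  1%:M + t *: delta_mx i j.

Lemma transvectionK t i j : i != j ->
  transvection (- t) i j *m transvection t i j = 1%:M.
Proof.
move=> ij; rewrite /transvection mulmxDl mul1mx mulmxDr mulmx1.
rewrite -!scalemxAl -!scalemxAr mul_delta_mx_0 1?eq_sym // !scaler0 addr0.
by rewrite scaleNr addrK.
Qed.

Lemma mulmx_transvectionE (b : 'M[F]_k) t i j p r :
  (b *m transvection t i j) p r = b p r + (if r == j then t * b p i else 0).
Proof.
rewrite /transvection mulmxDr mulmx1 mxE -scalemxAr mxE; congr (_ + _).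
rewrite mxE (bigD1 i) //= big1 => [|l li].
  rewrite mxE eqxx /= addr0 mulrC -mulrA [_%:R * _]mulrC.
  by case: eqP => _; rewrite ?mulr1 ?mulr0 // mulrC.
by rewrite mxE (negPf li) mulr0.
Qed.

Lemma transvection_borel t (i j : 'I_k) :
  (i < j)%N -> transvection t i j \in borel.
Proof.
move=> ij; have ij' : i != j by rewrite -val_eqE neq_ltn ij.
apply/borelP; split=> [|p r rp].
  by have [] := mulmx1_unit (transvectionK t ij').
rewrite !mxE; have -> : (p == r) = false by rewrite -val_eqE gtn_eqF.
case: (boolP (_ && _)) => [/andP[/eqP pi /eqP rj]|_]; last first.
  by rewrite mulr0 addr0.
by rewrite pi rj ltnNge ltnW in rp.
Qed.

Local Notation s := (simple_refl d).

Section OneReflection.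
Variable i : nat.
Hypothesis id : (i < d)%N.
Local Notation i0 := (inord i : 'I_k).
Local Notation i1 := (inord i.+1 : 'I_k).

Let i0E : val i0 = i. Proof. by rewrite /= inordK //; lia. Qed.
Let i1E : val i1 = i.+1. Proof. by rewrite /= inordK //; lia. Qed.
Let i01 : i0 != i1. Proof. by rewrite -val_eqE i0E i1E; lia. Qed.

Lemma perm_simple_reflK : perm_mx (s i) *m perm_mx (s i) = 1%:M :> 'M[F]_k.
Proof. by rewrite -perm_mxM /s tperm2 perm_mx1. Qed.

Lemma mulmx_simple_reflE (b : 'M[F]_k) p r :
  (b *m perm_mx (s i)) p r = b p (s i r).
Proof. by rewrite -{1}[s i]invgK -col_permE mxE /s tpermV. Qed.

Lemma simple_refl_mulmxE (b : 'M[F]_k) p r :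
  (perm_mx (s i) *m b) p r = b (s i p) r.
Proof. by rewrite -row_permE mxE. Qed.

Lemma simple_refl_ltn (p r : 'I_k) : (p < r)%N -> (s i r <= s i p)%N ->
  p = i0 /\ r = i1.
Proof.
have := i0E; have := i1E; rewrite /s /= => e1 e0.
case: tpermP => [->|->|/eqP + /eqP]; case: tpermP => [->|->|/eqP + /eqP];
  rewrite -?val_eqE /= ?e0 ?e1 //; try lia.
Qed.

Lemma perm_simple_refl_unit : perm_mx (s i) \in @unitmx F k.
Proof. exact: unitmx_perm. Qed.

Lemma simple_refl_conj_borel b : b \in borel -> b i0 i1 = 0 ->
  perm_mx (s i) *m b *m perm_mx (s i) \in borel.
Proof.
move=> /borelP[ub bB] b0; apply/borelP; split=> [|p r rp].
  by rewrite !unitmx_mul ub !perm_simple_refl_unit.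
rewrite mulmx_simple_reflE simple_refl_mulmxE.
have [sps|spr] := leqP (s i p) (s i r); last exact: bB.
by have [-> ->] := simple_refl_ltn rp sps; rewrite /s tpermL tpermR.
Qed.

(** The condition says that multiplying t by s_i increases its length. Each b splits as m times a
    transvection at (i0, i1), with s m s again in the Borel; t moves the transvection to position (t
    i0, t i1), still above the diagonal, and both factors are absorbed. *)
Lemma double_coset_simple_refl_mul (t : 'S_k) : (t i0 < t i1)%N ->
  double_coset K (perm_mx (s i)) *m double_coset K (perm_mx t) =
  double_coset K (perm_mx (s i * t)%g : 'M[F]_k).
Proof.
move=> t01; rewrite double_cosetM; apply: average_const (borel_neq0 F d) _ => b bB.
pose a := b i0 i1 / b i0 i0.
have b00 := borel_diag_neq0 i0 bB.
pose m := b *m transvection (- a) i0 i1.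
have mB : m \in borel.
  by apply: borelM => //; apply: transvection_borel; rewrite i0E i1E.
have m0 : m i0 i1 = 0.
  by rewrite mulmx_transvectionE eqxx /a; field.
rewrite -(double_cosetB K (perm_mx (s i * t)%g)
  (simple_refl_conj_borel mB m0) (transvection_borel a t01)).
congr double_coset; rewrite perm_mxM.
have -> : perm_mx (s i) *m m *m perm_mx (s i) *m (perm_mx (s i) *m perm_mx t) *m
  transvection a (t i0) (t i1) =
  perm_mx (s i) *m m *m (perm_mx t *m transvection a (t i0) (t i1)).
  by rewrite !mulmxA -(mulmxA _ (perm_mx (s i)) (perm_mx (s i)))
    perm_simple_reflK mulmx1.
have -> : perm_mx t *m transvection a (t i0) (t i1) =
          transvection a i0 i1 *m perm_mx t :> 'M[F]_k.
  rewrite /transvection mulmxDl mulmxDr mulmx1 mul1mx; congr (_ + _).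
  rewrite -scalemxAl -scalemxAr; congr (_ *: _); apply/matrixP => p r.
  rewrite -row_permE -[t in RHS]invgK -col_permE !mxE (inj_eq perm_inj).
  by rewrite -{1}[r](permKV t) (inj_eq perm_inj).
by rewrite /m !mulmxA -(mulmxA _ (transvection _ _ _)
  (transvection _ _ _)) transvectionK // mulmx1.
Qed.

Lemma double_coset_simple_refl_conj b : b \in borel -> b i0 i1 != 0 ->
  double_coset K (perm_mx (s i) *m b *m perm_mx (s i)) =
  double_coset K (perm_mx (s i) : 'M[F]_k).
Proof.
move=> bB b01; have [ub bt] := borelP _ bB.
(* This x clears the only entry of m below the diagonal, at (i1, i0), whose value is b_00 - x
   b_01. *)
pose x := b i0 i0 / b i0 i1.
pose m := perm_mx (s i) *m b *m perm_mx (s i) *m transvection (- x) i0 i1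
            *m perm_mx (s i).
have i01n : (i0 < i1)%N by rewrite i0E i1E.
have tB := transvection_borel x i01n.
have mB : m \in borel.
  apply/borelP; split=> [|p r rp].
    by rewrite !unitmx_mul ub !perm_simple_refl_unit !borel_unit //
      transvection_borel.
  rewrite mulmx_simple_reflE mulmx_transvectionE !mulmx_simple_reflE.
  rewrite !simple_refl_mulmxE /s tpermK tpermL.
  have -> : (tperm i0 i1 r == i1) = (r == i0).
    by rewrite -[X in _ == X](tpermL i0 i1) (inj_eq perm_inj).
  have [ri|ri] := eqVneq r i0; last first.
    rewrite addr0; apply: bt; case: tpermP => [pi|pi|//] /=.
      by move: rp; rewrite pi; have := i0E; have := i1E; simpl; lia.
    move: rp ri; rewrite pi -val_eqE /=; have := i0E; have := i1E; simpl; lia.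
  case: tpermP => [pi|pi|/eqP p0 /eqP p1].
  - by move: rp; rewrite ri pi ltnn.
  - by rewrite ri /x; field.
  - rewrite !bt ?mulr0 ?addr0 //; move: rp p0 p1; rewrite ri -!val_eqE /=;
      have := i0E; have := i1E; simpl; lia.
rewrite -(double_cosetB K (perm_mx (s i)) mB tB) /m; congr double_coset.
rewrite -(mulmxA _ (perm_mx (s i)) (perm_mx (s i))) perm_simple_reflK mulmx1.
by rewrite -(mulmxA _ (transvection _ _ _)
  (transvection _ _ _)) transvectionK // mulmx1.
Qed.

(** Transvections at (i0, i1) permute the fibers of b_01 / b_00 transitively, so the entry vanishes
    on a fraction 1/q of the Borel. This is the coefficient q^-1 of the squared double coset. *)
Lemma card_borel_entry0 :
  (#|borel| = #|F| * #|[set b in borel | b i0 i1 == 0%R]|)%N.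
Proof.
pose t (b : 'M[F]_k) := b i0 i1 / b i0 i0.
rewrite -sum1_card (partition_big t predT) //= -sum_nat_const.
apply: eq_bigr => a _; rewrite -sum1_card.
have i01n : (i0 < i1)%N by rewrite i0E i1E.
have tK c : cancel (mulmx^~ (transvection c i0 i1 : 'M[F]_k))
                   (mulmx^~ (transvection (- c) i0 i1 : 'M[F]_k)).
  by move=> b; rewrite -mulmxA -{1}[c]opprK transvectionK // mulmx1.
rewrite (reindex (mulmx^~ (transvection a i0 i1))) /=; last first.
  exists (mulmx^~ (transvection (- a) i0 i1)) => b _; first exact: tK.
  by rewrite -mulmxA transvectionK // mulmx1.
apply: eq_bigl => b; rewrite [RHS]inE.
have -> : (b *m transvection a i0 i1 \in borel) = (b \in borel).
  apply/idP/idP => bB; last by apply: borelM => //; apply: transvection_borel.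
  by rewrite -(tK _ a b); apply: borelM => //; apply: transvection_borel.
have [bB|//] := boolP (b \in borel); rewrite /= /t !mulmx_transvectionE eqxx.
rewrite (negPf i01) addr0 mulrDl mulfK ?borel_diag_neq0 //.
rewrite -[X in _ == X]add0r (inj_eq (addIr _)) mulf_eq0 invr_eq0 (negPf (borel_diag_neq0 _ bB)).
by rewrite orbF.
Qed.

Lemma double_coset_simple_refl_sqr :
  double_coset K (perm_mx (s i)) *m double_coset K (perm_mx (s i)) =
  q^-1 *: e + (1 - q^-1) *: double_coset K (perm_mx (s i) : 'M[F]_k).
Proof.
have F0 : q != 0 by rewrite pnatr_eq0 -lt0n; apply/card_gt0P; exists 0.
set Z := [set b in borel | b i0 i1 == 0%R].
have cB := card_borel_entry0; rewrite -/Z in cB.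
have Z0 : #|Z|%:R != 0 :> K.
  rewrite pnatr_eq0; apply/eqP => z0.
  by move/eqP: cB; rewrite z0 muln0 cards_eq0 (negPf (borel_neq0 F d)).
rewrite double_cosetM (bigID (fun b : 'M[F]_k => b i0 i1 == 0)) /=.
rewrite (eq_bigr (fun=> e)); last first.
  move=> b /andP[bB /eqP b0]; rewrite -(double_coset1 K F d).
  rewrite -[perm_mx _ *m _ *m _]mul1mx -(double_cosetB K 1%:M (borel1 F d)
    (simple_refl_conj_borel bB b0)).
  by rewrite !mul1mx.
rewrite [X in _ + X](eq_bigr (fun=> double_coset K (perm_mx (s i)))); last first.
  by move=> b /andP[bB b0]; rewrite double_coset_simple_refl_conj.
rewrite !sumr_const.
have -> : #|[pred b | (b \in borel) && (b i0 i1 == 0)]| = #|Z|.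
  by apply: eq_card => b; rewrite !inE.
have -> : #|[pred b | (b \in borel) && (b i0 i1 != 0)]| = (#|borel| - #|Z|)%N.
  have -> : #|[pred b | (b \in borel) && (b i0 i1 != 0)]| = #|borel :\: Z|.
    apply: eq_card => b; rewrite in_setD [b \in Z]in_set [LHS]inE.
    by case: (b \in borel); rewrite /= ?andbF ?andbT.
  rewrite cardsD; congr (_ - _)%N; apply: eq_card => b.
  by rewrite in_setI [b \in Z]in_set andbA andbb.
rewrite scalerDr -!scaler_nat !scalerA natrB; last first.
  by apply: subset_leq_card; apply/subsetP => b; rewrite inE => /andP[].
rewrite cB natrM; congr (_ *: _ + _ *: _); field; exact/andP.
Qed.

End OneReflection.

(** The factor q is the number of Borel cosets in the double coset of s_i: [double_coset] averages
    over it, whereas T_i is the sum over it divided by the order of the Borel. *)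
Definition hecke_gen (i : nat) : 'M[K]_#|{: GLmx F d}| :=
  q *: double_coset K (perm_mx (s i) : 'M[F]_k).

Let qn0 : q != 0.
Proof. by rewrite pnatr_eq0 -lt0n; apply/card_gt0P; exists 0. Qed.

Lemma hecke_gen_quad i : (i < d)%N ->
  hecke_gen i *m hecke_gen i = (q - 1) *: hecke_gen i + q *: e.
Proof.
move=> id; rewrite /hecke_gen -scalemxAl -scalemxAr.
rewrite double_coset_simple_refl_sqr //.
move: (double_coset _ _) e => D E; rewrite !scalerDr !scalerA addrC.
by congr (_ *: _ + _ *: _); field.
Qed.

Lemma hecke_gen_comm i j : (i.+1 < j)%N -> (j < d)%N ->
  hecke_gen i *m hecke_gen j = hecke_gen j *m hecke_gen i.
Proof.
move=> ij jd; rewrite /hecke_gen -!scalemxAl -!scalemxAr.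
have ids : (i < d)%N by lia.
have i0 : s j (inord i) = inord i by apply: simple_refl_fix; lia.
have i1 : s j (inord i.+1) = inord i.+1 by apply: simple_refl_fix; lia.
have j0 : s i (inord j) = inord j by apply: simple_refl_fix; lia.
have j1 : s i (inord j.+1) = inord j.+1 by apply: simple_refl_fix; lia.
have ltj : (s i (inord j) < s i (inord j.+1))%N.
  by rewrite j0 j1 inord_ltn //; lia.
have lti : (s j (inord i) < s j (inord i.+1))%N.
  by rewrite i0 i1 inord_ltn //; lia.
rewrite (@double_coset_simple_refl_mul i ids (s j) lti).
rewrite (@double_coset_simple_refl_mul j jd (s i) ltj).
congr (_ *: (_ *: double_coset _ (perm_mx _))).
by rewrite -[RHS]mulg1 -(tperm2 (inord j) (inord j.+1)) mulgA simple_refl_conj i0 i1.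
Qed.

Lemma hecke_gen_braid i : (i.+1 < d)%N ->
  hecke_gen i *m hecke_gen i.+1 *m hecke_gen i =
  hecke_gen i.+1 *m hecke_gen i *m hecke_gen i.+1.
Proof.
move=> id; have id' : (i < d)%N by lia.
have mul_refl j (t : 'S_k) : (j < d)%N -> (t (inord j) < t (inord j.+1))%N ->
    double_coset K (perm_mx (s j)) *m double_coset K (perm_mx t) =
    double_coset K (perm_mx (s j * t)%g : 'M[F]_k).
  by move=> jd; apply: double_coset_simple_refl_mul.
have i2 : s i (inord i.+2) = inord i.+2 by apply: simple_refl_fix; lia.
have i0 : s i.+1 (inord i) = inord i by apply: simple_refl_fix; lia.
rewrite /hecke_gen -!scalemxAl -!scalemxAr -!scalemxAl.
have braidE a b : (a < d)%N -> (b < d)%N ->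
    (s a (inord b) < s a (inord b.+1))%N ->
    ((s b * s a)%g (inord a) < (s b * s a)%g (inord a.+1))%N ->
    double_coset K (perm_mx (s a)) *m double_coset K (perm_mx (s b)) *m
    double_coset K (perm_mx (s a)) =
    double_coset K (perm_mx (s a * (s b * s a))%g : 'M[F]_k).
  move=> ad bd h1 h2; rewrite -(mulmxA (double_coset K (perm_mx (s a)))
    (double_coset K (perm_mx (s b))) (double_coset K (perm_mx (s a)))).
  by rewrite (mul_refl b (s a) bd h1) (mul_refl a _ ad h2).
have h1 : (s i (inord i.+1) < s i (inord i.+2))%N.
  by rewrite simple_refl_r i2 inord_ltn.
have h2 : (s i.+1 (inord i) < s i.+1 (inord i.+1))%N.
  by rewrite simple_refl_l i0 inord_ltn.
have h3 : ((s i.+1 * s i)%g (inord i) < (s i.+1 * s i)%g (inord i.+1))%N.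
  by rewrite !permM i0 !simple_refl_l i2 inord_ltn.
have h4 : ((s i * s i.+1)%g (inord i.+1) < (s i * s i.+1)%g (inord i.+2))%N.
  by rewrite !permM i2 !simple_refl_r i0 inord_ltn.
congr (_ *: (_ *: (_ *: _))).
apply: (etrans (braidE i i.+1 id' id h1 h3)).
apply: (etrans _ (esym (braidE i.+1 i id id' h2 h4))).
congr (double_coset _ (perm_mx _)).
by rewrite !mulgA !simple_refl_conj i0 i2 simple_refl_r simple_refl_l.
Qed.

End SimpleReflections.

(** * Compression to the Borel-invariants *)

(** The Hecke relations hold with e in the role of 1. A rank factorization of e carries them to
    matrices of size rank e, where e becomes the identity; [r.+1] makes these matrices a nonzero
    ring. *)
Lemma idempotent_splitting (K : fieldType) n (e : 'M[K]_n) :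
  e *m e = e -> e != 0 ->
  exists r (L : 'M[K]_(n, r.+1)) (M : 'M[K]_(r.+1, n)),
    L *m M = e /\ M *m L = 1%:M.
Proof.
move=> ee e0; have : (0 < \rank e)%N by rewrite lt0n mxrank_eq0.
have := mulmx_base e; have := row_base_free e; have := col_base_full e.
case: (\rank e) (col_base e) (row_base e) => // r L M fL fM LM _.
exists r, L, M; split=> //.
apply: (row_free_inj fM); apply: (row_full_inj fL).
by rewrite mul1mx !mulmxA LM -mulmxA LM ee.
Qed.

Section Realization.
Variables (K : numFieldType) (F : finFieldType) (d : nat).
Local Notation k := d.+1.
Local Notation q := (#|F|%:R : K).
Local Notation e := (borel_idem K F d).
Local Notation borel := (borel F d).
Local Notation gen := (@hecke_gen K F d).
Local Notation N := #|{: GLmx F d}|.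
Local Notation dc := (@double_coset K F d).

Lemma double_coset_idem_l x : e *m dc x = dc x.
Proof. by rewrite /double_coset !mulmxA borel_idemM. Qed.

Lemma double_coset_idem_r x : dc x *m e = dc x.
Proof. by rewrite /double_coset -mulmxA borel_idemM. Qed.

(** Entry (i, j) of a translation by x is nonzero exactly when x = g_i^-1 g_j, so the condition says
    which translations may occur in A. *)
Definition supported (S : {set 'M[F]_k}) (A : 'M[K]_N) : Prop :=
  forall i j, A i j != 0 -> invmx (val (enum_val i)) *m val (enum_val j) \in S.

Lemma supported_sub (S S' : {set 'M[F]_k}) A :
  S \subset S' -> supported S A -> supported S' A.
Proof. by move=> /subsetP SS' SA i j /SA/SS'. Qed.

Lemma supportedM (S S' U : {set 'M[F]_k}) A B :
  {in S & S', forall x y, x *m y \in U} ->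
  supported S A -> supported S' B -> supported U (A *m B).
Proof.
move=> SU SA SB i j; rewrite mxE => ne0.
have [l /andP[Al Bl]] : exists l, (A i l != 0) && (B l j != 0).
  apply/existsP; apply: contraNT ne0; rewrite negb_exists => /forallP nex.
  rewrite big1 // => l _; apply/eqP; rewrite mulf_eq0.
  by have := nex l; rewrite negb_and !negbK.
have := SU _ _ (SA _ _ Al) (SB _ _ Bl).
by rewrite mulmxA -(mulmxA (invmx _)) mulmxV ?mulmx1 // (valP (enum_val l)).
Qed.

Lemma supportedD S A B : supported S A -> supported S B -> supported S (A + B).
Proof.
move=> SA SB i j; rewrite mxE => ne0.
have [A0|] := eqVneq (A i j) 0; last exact: SA.
by apply: SB; move: ne0; rewrite A0 add0r.
Qed.

Lemma supportedZ S c A : supported S A -> supported S (c *: A).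
Proof. by move=> SA i j; rewrite mxE mulf_eq0 negb_or => /andP[_ /SA]. Qed.

Lemma supported_sum S (I : finType) (P : pred I) (A : I -> 'M[K]_N) :
  (forall i, P i -> supported S (A i)) -> supported S (\sum_(i | P i) A i).
Proof.
move=> SA; apply: (big_ind (supported S)) => //; last exact: supportedD.
by move=> i j; rewrite mxE eqxx.
Qed.

Lemma supported_translation x : supported [set x] (translation K x).
Proof.
move=> i j; rewrite mxE; case: (_ *m _ =P _) => [<- _|_]; last by rewrite eqxx.
by rewrite inE mulKmx // (valP (enum_val i)).
Qed.

Lemma supported_borel_idem : supported borel e.
Proof.
apply/supportedZ/supported_sum => b bB.
by apply: (@supported_sub [set b]); rewrite ?sub1set //;
  exact: supported_translation.
Qed.

Lemma supported_double_coset (S : {set 'M[F]_k}) x :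
  {in borel & borel, forall b b', b *m x *m b' \in S} -> supported S (dc x).
Proof.
move=> BS; apply: (supportedM (S := [set b *m x | b in borel]) _ _ supported_borel_idem).
  by move=> _ b' /imsetP[b bB ->] b'B; apply: BS.
apply: (supportedM _ supported_borel_idem (@supported_translation x)).
by move=> b y bB; rewrite inE => /eqP->; apply/imsetP; exists b.
Qed.

(** Stabilizer of the span of the first j + 1 coordinate vectors: the maximal standard parabolic
    containing every simple reflection except s_j. *)
Definition parabolic (j : nat) : {set 'M[F]_k} :=
  [set x | (x \in unitmx) &&
    [forall a : 'I_k, forall b : 'I_k, (b <= j < a)%N ==> (x a b == 0)]].

Lemma parabolicP j x : reflect
  (x \in unitmx /\ forall a b : 'I_k, (b <= j)%N -> (j < a)%N -> x a b = 0)
  (x \in parabolic j).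
Proof.
rewrite inE; apply: (iffP andP) => -[ux px]; split=> //.
  move=> a b bj ja; move/forallP/(_ a)/forallP/(_ b)/implyP: px.
  by rewrite bj ja => /(_ isT)/eqP.
apply/forallP => a; apply/forallP => b; apply/implyP => /andP[bj ja].
by rewrite px.
Qed.

Lemma parabolicM j : {in parabolic j &, forall x y, x *m y \in parabolic j}.
Proof.
move=> x y /parabolicP[ux px] /parabolicP[uy py]; apply/parabolicP.
split=> [|a b bj ja]; first by rewrite unitmx_mul ux.
rewrite mxE big1 // => l _; have [lj|jl] := leqP l j.
  by rewrite px ?mul0r.
by rewrite py ?mulr0.
Qed.

Lemma borel_parabolic j : borel \subset parabolic j.
Proof.
apply/subsetP => x /borelP[ux bx]; apply/parabolicP; split=> // a b bj ja.
by apply: bx; lia.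
Qed.

Lemma parabolicV j x : x \in parabolic j -> invmx x \in parabolic j.
Proof.
move=> xP; apply: (submonoid_inv _ (@parabolicM j) xP).
  exact: (subsetP (borel_parabolic j)) (borel1 F d).
by case/parabolicP: xP.
Qed.

Lemma perm_mxE (s : 'S_k) a b : (perm_mx s : 'M[F]_k) a b = (s a == b)%:R.
Proof. by rewrite !mxE. Qed.

Lemma simple_refl_parabolic i j : (i < d)%N -> i != j ->
  perm_mx (simple_refl d i) \in parabolic j.
Proof.
move=> id ij; apply/parabolicP; split=> [|a b bj ja].
  exact: unitmx_perm.
rewrite perm_mxE -val_eqE /= val_simple_refl //.
by case: (_ =P i) => ?; [|case: (_ =P i.+1) => ?]; case: eqP => //; lia.
Qed.

Lemma simple_refl_notin_parabolic j : (j < d)%N ->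
  perm_mx (simple_refl d j) \notin parabolic j.
Proof.
move=> jd; apply/negP => /parabolicP[_ /(_ (inord j.+1) (inord j))].
rewrite !inordK; try lia.
rewrite perm_mxE simple_refl_r eqxx => /(_ (leqnn _) (ltnSn _))/eqP.
by rewrite oner_eq0.
Qed.

Lemma supported_hecke_gen i j : (i < d)%N -> i != j ->
  supported (parabolic j) (gen i).
Proof.
move=> id ij; apply/supportedZ/supported_double_coset => b b' bB b'B.
have BP := subsetP (borel_parabolic j).
apply: parabolicM (BP _ b'B); apply: parabolicM (BP _ bB) _.
exact: simple_refl_parabolic.
Qed.

Lemma supported_hecke_gen_compl j : (j < d)%N ->
  supported (~: parabolic j) (gen j).
Proof.
move=> jd; apply/supportedZ/supported_double_coset => b b' bB b'B.
have BP := subsetP (borel_parabolic j).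
rewrite inE; apply: contra (simple_refl_notin_parabolic jd) => xP.
have -> : perm_mx (simple_refl d j) =
    invmx b *m (b *m perm_mx (simple_refl d j) *m b') *m invmx b' :> 'M[F]_k.
  by rewrite !mulmxA mulmxK ?mulVmx ?mul1mx // borel_unit.
apply: parabolicM (BP _ (borelV b'B)).
exact: parabolicM (BP _ (borelV bB)) xP.
Qed.

(** A diagonal term of the product would need some x in the parabolic with x^-1 outside it. *)
Lemma trace_supported_compl j A B :
  supported (parabolic j) A -> supported (~: parabolic j) B ->
  \tr (A *m B) = 0.
Proof.
move=> SA SB; rewrite /mxtrace big1 // => a _; rewrite mxE big1 // => b _.
apply/eqP; apply: contraT; rewrite mulf_eq0 negb_or => /andP[/SA pa /SB].
rewrite inE => /negP[]; have := parabolicV pa.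
set g := val _; set h := val _.
have [ug uh] : g \in unitmx /\ h \in unitmx by split; exact: valP.
have ux : invmx g *m h \in unitmx by rewrite unitmx_mul unitmx_inv ug.
suff -> : invmx (invmx g *m h) = invmx h *m g by [].
by rewrite -[RHS](mulKmx ux) !mulmxA mulmxK // mulmxKV.
Qed.

Lemma double_coset_coxeterS i g : (i + g < d)%N ->
  dc (perm_mx (coxeter d i g.+1)) =
  dc (perm_mx (simple_refl d i)) *m dc (perm_mx (coxeter d i.+1 g)).
Proof.
move=> ig; rewrite double_coset_simple_refl_mul //; first by lia.
have [i0 i1] : (i < k)%N /\ (i.+1 < k)%N by lia.
have v0 : coxeter d i.+1 g (inord i) = i :> nat.
  rewrite val_coxeter ?inordK //.
  by rewrite (ltn_eqF (ltnSn i)) ltnNge leqnSn.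
have v1 : coxeter d i.+1 g (inord i.+1) = (i.+1 + g)%N :> nat.
  by rewrite val_coxeter ?inordK ?eqxx.
by rewrite v0 v1; lia.
Qed.

Lemma trace_borel_idem : \tr e = N%:R / #|borel|%:R.
Proof.
rewrite /borel_idem /average mxtraceZ raddf_sum /= (bigD1 1%:M) ?borel1 //=.
rewrite trace_translation eqxx big1 ?addr0 1?mulrC // => b /andP[_ b1].
by rewrite trace_translation (negPf b1).
Qed.

Lemma card_GLmx_gt0 : (0 < N)%N.
Proof. by apply/card_gt0P; exists (Sub 1%:M (unitmx1 _ _) : GLmx F d). Qed.

Lemma borel_idem_neq0 : e != 0.
Proof.
apply: contraTneq card_GLmx_gt0 => e0.
have /eqP := trace_borel_idem; rewrite e0 mxtrace0 eq_sym mulf_eq0 invr_eq0.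
by rewrite !pnatr_eq0 cards_eq0 (negPf (borel_neq0 F d)) orbF => /eqP->.
Qed.

Lemma hecke_gen_idem_l i : e *m gen i = gen i.
Proof. by rewrite -scalemxAr double_coset_idem_l. Qed.

Lemma hecke_gen_idem_r i : gen i *m e = gen i.
Proof. by rewrite -scalemxAl double_coset_idem_r. Qed.

Section Corner.
Variables (r : nat) (L : 'M[K]_(N, r.+1)) (M : 'M[K]_(r.+1, N)).
Hypotheses (LM : L *m M = e) (ML : M *m L = 1%:M).

Definition corner (A : 'M[K]_N) : 'M[K]_r.+1 := M *m A *m L.

Lemma cornerM A B : A *m e = A -> corner A * corner B = corner (A *m B).
Proof.
move=> Ae; rewrite /corner -mulmxE !mulmxA -(mulmxA _ L M) LM.
by rewrite -(mulmxA M A e) Ae.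
Qed.

Lemma cornerE : corner e = 1.
Proof. by rewrite /corner -LM !mulmxA ML mul1mx ML. Qed.

Lemma trace_corner A : A *m e = A -> \tr (corner A) = \tr A.
Proof. by move=> Ae; rewrite /corner -mulmxA mxtrace_mulC -mulmxA LM Ae. Qed.

Lemma cornerD A B : corner (A + B) = corner A + corner B.
Proof. by rewrite /corner mulmxDr mulmxDl. Qed.

Lemma cornerZ a A : corner (a *: A) = a *: corner A.
Proof. by rewrite /corner -scalemxAr -scalemxAl. Qed.

Lemma hecke_family_corner : hecke_family q (corner \o gen) k.
Proof.
have he := hecke_gen_idem_r.
have he2 i j : gen i *m gen j *m e = gen i *m gen j by rewrite -mulmxA he.
have corner2 i j : corner (gen i) * corner (gen j) = corner (gen i *m gen j).
  exact: cornerM (gen j) (he i).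
have corner3 i j l : corner (gen i) * corner (gen j) * corner (gen l) =
    corner (gen i *m gen j *m gen l).
  by rewrite corner2; apply: cornerM (gen l) (he2 i j).
split=> [i ik|i ik|i j ij jk] /=.
- rewrite corner2 hecke_gen_quad // cornerD (cornerZ _ e) (cornerZ _ (gen i)).
  by rewrite cornerE.
- apply: (etrans (corner3 i i.+1 i)); apply: (etrans _ (esym (corner3 _ _ _))).
  by congr corner; apply: hecke_gen_braid.
- apply: (etrans (corner2 i j)); apply: (etrans _ (esym (corner2 j i))).
  by congr corner; apply: hecke_gen_comm.
Qed.

Lemma corner_chain i g : (i + g <= d)%N ->
  hecke_chain (corner \o gen) i g =
  q ^+ g *: corner (dc (perm_mx (coxeter d i g))).
Proof.
elim: g i => [|g IH] i ig.
  by rewrite /= perm_mx1 double_coset1 cornerE scale1r.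
rewrite hecke_chain_recl IH; last by lia.
rewrite -scalerAr (cornerM _ (hecke_gen_idem_r i)) double_coset_coxeterS; last by lia.
rewrite /hecke_gen -scalemxAl (cornerZ q) scalerA -exprSr.
by [].
Qed.

Lemma trace_corner_sym_asym a : (a <= k)%N ->
  \tr (sym_asym q (corner \o gen) k a) =
  r.+1%:R / (qfact q a * qfact q^-1 (k - a)).
Proof.
move=> ak; have q0 : 0 < q.
  by rewrite ltr0n; apply/card_gt0P; exists 0.
(* Supports make sense only for matrices indexed by the group, so X is first carried back from the
   corner. *)
pose S j (X : 'M[K]_r.+1) := supported (parabolic j) (L *m X *m M).
have LgenM i : L *m corner (gen i) *m M = gen i.
  rewrite /corner !mulmxA LM -mulmxA LM hecke_gen_idem_l.
  exact: hecke_gen_idem_r.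
rewrite (trace_sym_asym_eval (S := S)) //.
- by rewrite mxtrace1.
- by move=> j X Y SX SY; rewrite /S mulmxDr mulmxDl; apply: supportedD.
- move=> j X Y SX SY; rewrite /S.
  have -> : L *m (X * Y) *m M = (L *m X *m M) *m (L *m Y *m M).
    by rewrite -mulmxE !mulmxA -(mulmxA _ M L) ML mulmx1.
  exact: supportedM (@parabolicM j) SX SY.
- by move=> j c X SX; rewrite /S -scalemxAr -scalemxAl; apply: supportedZ.
- move=> j; rewrite /S mulmx1 LM.
  exact: supported_sub (borel_parabolic j) supported_borel_idem.
- by move=> j l jk lk lj; rewrite /S /= LgenM; apply: supported_hecke_gen.
- exact: mxtraceD.
- exact: mxtraceZ.
- by move=> X Y; rewrite -!mulmxE mxtrace_mulC.
move=> j X jk SX; have -> : \tr (X * corner (gen j)) = \tr (L *m X *m M *m gen j).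
  by rewrite -mulmxE /corner !mulmxA mxtrace_mulC !mulmxA.
exact: trace_supported_compl SX (supported_hecke_gen_compl jk).
Qed.

End Corner.

End Realization.

(** * The Coxeter element as a companion step *)

Lemma card_entrywise (T : finType) m n (Q : 'I_m -> 'I_n -> pred T) :
  #|[set A : 'M[T]_(m, n) | [forall i, forall j, Q i j (A i j)]]| =
  (\prod_(i < m) \prod_(j < n) #|Q i j|)%N.
Proof.
pose P (u : 'I_m * 'I_n) : pred T := Q u.1 u.2.
rewrite pair_big /=; transitivity #|family P|; last first.
  by rewrite card_family foldrE big_image.
pose f (A : 'M[T]_(m, n)) : {ffun 'I_m * 'I_n -> T} := [ffun u => A u.1 u.2].
have f_inj : injective f.
  by move=> A B /ffunP AB; apply/matrixP => i j; have := AB (i, j); rewrite !ffunE.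
rewrite -(card_imset _ f_inj); apply: eq_card => u.
apply/imsetP/familyP => [[A + ->] [i j]|uP].
  by rewrite inE ffunE => /forallP/(_ i)/forallP/(_ j).
exists (\matrix_(i, j) u (i, j)).
  by rewrite inE; apply/forallP => i; apply/forallP => j; rewrite mxE; have := uP (i, j).
by apply/ffunP => -[i j]; rewrite ffunE mxE.
Qed.

(** To be used with p the Coxeter translation, e the Borel average and h the smaller average of a
    walk step: the exchange e p e = e p h propagates through a whole power. *)
Lemma sandwich_pow (R : pzSemiRingType) (e p h : R) m :
  e * e = e -> e * p * e = e * p * h ->
  e * (e * p * e) ^+ m = e * (p * h) ^+ m.
Proof.
move=> ee eph; have absorb n : e * (p * e) ^+ n * e = e * (p * e) ^+ n.
  by case: n => [|n]; rewrite ?expr0 ?mulr1 // exprSr -!mulrA ee.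
have -> : e * (p * h) ^+ m = e * (p * e) ^+ m.
  elim: m => [|m IH]; first by rewrite !expr0.
  rewrite !exprSr !mulrA IH -absorb -2!mulrA (mulrA e p) -eph.
  by rewrite !mulrA absorb.
elim: m => [|m IH]; first by rewrite !expr0.
by rewrite !exprSr !mulrA IH absorb.
Qed.

Lemma scalemx_exp (R : comPzRingType) N (a : R) (A : 'M[R]_N) n :
  (a *: A) ^+ n = a ^+ n *: A ^+ n.
Proof.
elim: n => [|n IH]; first by rewrite !expr0 scale1r.
by rewrite !exprS IH -!mulmxE -scalemxAl -scalemxAr scalerA.
Qed.

Section CompanionWalks.
Variables (K : numFieldType) (F : finFieldType) (d : nat).
Local Notation k := d.+1.
Local Notation q := (#|F|%:R : K).
Local Notation e := (borel_idem K F d).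
Local Notation borel := (borel F d).
Local Notation N := #|{: GLmx F d}|.
Local Notation dc := (@double_coset K F d).
Local Notation P := (@translation K F d).

(** Right multiplication by the Coxeter permutation shifts a window by one column; this group then
    replaces the last column by an arbitrary one that keeps the window invertible. *)
Definition last_col_group : {set 'M[F]_k} :=
  [set x : 'M[F]_k | (x \in unitmx) &&
    [forall j : 'I_k, (j != ord_max) ==> (col j x == col j 1%:M)]].
Local Notation H := last_col_group.

Lemma last_col_groupP x : reflect
  (x \in unitmx /\ forall j, j != ord_max -> col j x = col j 1%:M) (x \in H).
Proof.
rewrite inE; apply: (iffP andP) => -[ux hx]; split=> //.
  by move=> j jm; move/forallP/(_ j)/implyP: hx => /(_ jm)/eqP.
by apply/forallP => j; apply/implyP => /hx->.
Qed.

Lemma last_col_group1 : 1%:M \in H.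
Proof. by apply/last_col_groupP; split=> //; exact: unitmx1. Qed.

Lemma last_col_group_unit x : x \in H -> x \in unitmx.
Proof. by case/last_col_groupP. Qed.

Lemma last_col_groupM : {in H &, forall x y, x *m y \in H}.
Proof.
move=> x y /last_col_groupP[ux hx] /last_col_groupP[uy hy].
apply/last_col_groupP; split=> [|j jm]; first by rewrite unitmx_mul ux.
have -> : col j (x *m y) = x *m col j y by rewrite !colE mulmxA.
rewrite hy //; transitivity (col j x); last exact: hx.
by rewrite !colE mul1mx.
Qed.

Lemma last_col_group_borel : H \subset borel.
Proof.
apply/subsetP => x /last_col_groupP[ux hx]; apply/borelP; split=> // i j ji.
have /hx/colP/(_ i) : j != ord_max.
  by apply/eqP => jm; move: ji; rewrite jm /=; have := ltn_ord i; lia.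
by rewrite !mxE => ->; rewrite -val_eqE gtn_eqF.
Qed.

Lemma last_col_group_borelE h y j : h \in H -> y \in borel -> j != ord_max ->
  col j (h *m y) = col j y.
Proof.
move=> /last_col_groupP[_ hh] /borelP[_ by_] jm; rewrite -[in RHS](mul1mx y).
apply/colP => i; rewrite !mxE; apply: eq_bigr => l _.
have [->|lm] := eqVneq l ord_max; last by have /colP/(_ i) := hh l lm; rewrite !mxE => ->.
rewrite by_ ?mulr0 //.
by move: jm; rewrite -val_eqE /=; have := ltn_ord j; lia.
Qed.

Lemma last_col_group_conj b h : b \in borel -> h \in H ->
  b *m h *m invmx b \in H.
Proof.
move=> bB hH; have ub := borel_unit bB; apply/last_col_groupP; split.
  by rewrite !unitmx_mul unitmx_inv ub last_col_group_unit.
move=> j jm.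
have -> : col j (b *m h *m invmx b) = b *m col j (h *m invmx b).
  by rewrite !colE !mulmxA.
by rewrite last_col_group_borelE ?borelV // !colE mulmxA mulmxV.
Qed.

Local Notation eH := (average K H).

Lemma average_last_col_r h : h \in H -> eH *m P h = eH.
Proof.
by move=> hH; apply: averager; rewrite ?last_col_group_unit //;
  exact: last_col_groupM.
Qed.

Lemma average_last_col_l h : h \in H -> P h *m eH = eH.
Proof.
by move=> hH; apply: averagel; rewrite ?last_col_group_unit //;
  exact: last_col_groupM.
Qed.

Lemma last_col_group_neq0 : H != set0.
Proof. by apply/set0Pn; exists 1%:M; exact: last_col_group1. Qed.

Lemma average_last_col_comm b : b \in borel -> eH *m P b = P b *m eH.
Proof.
move=> bB; have ub := borel_unit bB.
have <- : eH *m P b *m eH = P b *m eH.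
  rewrite -{1}[eH]mul1mx -2!mulmxA mulmxA.
  rewrite mulmx_averageE; apply: average_const last_col_group_neq0 _ => h hH.
  rewrite mul1mx mulmxA translationM -[h *m b](mulKVmx ub) -translationM -mulmxA.
  rewrite average_last_col_l //.
  by have := last_col_group_conj (borelV bB) hH; rewrite invmxK mulmxA.
rewrite -[X in _ = X]mulmx1 mulmx_averageE; symmetry.
apply: average_const last_col_group_neq0 _ => h hH.
rewrite mulmx1 -mulmxA translationM -[b *m h](mulmxKV ub) -translationM mulmxA.
by rewrite average_last_col_r // last_col_group_conj.
Qed.

Lemma borel_diag (x : 'M[F]_k) : (forall i j : 'I_k, (j < i)%N -> x i j = 0) ->
  (forall i, x i i != 0) -> x \in borel.
Proof.
move=> x0 xd; apply/borelP; split=> //; rewrite unitmxE -det_tr det_trig.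
  by rewrite unitfE; apply/prodf_neq0 => i _; rewrite mxE.
by apply/is_trig_mxP => i j ij; rewrite mxE x0.
Qed.

(** The factor b' is made trivial in its last column because that column is what the Coxeter cycle
    moves to the front; otherwise conjugation would leave the Borel. *)
Lemma borel_last_col_split b : b \in borel ->
  exists b' h, [/\ b' \in borel, h \in H, b = b' *m h,
    (forall i, b' i ord_max = (i == ord_max)%:R)
    & forall i j, j != ord_max -> b' i j = b i j].
Proof.
move=> bB; have [ub b0] := borelP _ bB.
pose b' : 'M[F]_k := \matrix_(i, j) if j == ord_max then (i == j)%:R else b i j.
have b'B : b' \in borel.
  apply: borel_diag => [i j ji|i]; rewrite mxE; case: ifP => _.
  - by rewrite -val_eqE gtn_eqF.
  - exact: b0.
  - by rewrite eqxx oner_neq0.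
  - exact: borel_diag_neq0.
have ub' := borel_unit b'B.
exists b', (invmx b' *m b); split=> //.
- apply/last_col_groupP; split; first by rewrite unitmx_mul unitmx_inv ub'.
  move=> j jm; have -> : col j (invmx b' *m b) = invmx b' *m col j b.
    by rewrite !colE mulmxA.
  have -> : col j b = col j b'.
    by apply/colP => i; rewrite !mxE (negPf jm).
  by rewrite !colE mulmxA mulVmx.
- by rewrite mulKVmx.
- by move=> i; rewrite mxE eqxx.
- by move=> i j jm; rewrite mxE (negPf jm).
Qed.

Local Notation sigma := (coxeter d 0 d).
Local Notation c := (perm_mx sigma : 'M[F]_k).

Lemma sigma_conjE (b : 'M[F]_k) i j :
  (c *m b *m invmx c) i j = b (sigma i) (sigma j).
Proof.
have -> : invmx c = perm_mx sigma^-1%g.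
  by rewrite -[RHS](mulKmx (unitmx_perm _ sigma)) -perm_mxM mulgV perm_mx1 mulmx1.
by rewrite -col_permE mxE -row_permE mxE.
Qed.

Lemma sigma_conj_borel b : b \in borel ->
  (forall i, b i ord_max = (i == ord_max)%:R) -> c *m b *m invmx c \in borel.
Proof.
move=> /borelP[ub b0] bm; apply/borelP; split.
  by rewrite !unitmx_mul ub unitmx_inv unitmx_perm.
move=> i j ji; rewrite sigma_conjE.
have [j0|j0] := eqVneq (j : nat) 0%N.
  have -> : sigma j = ord_max by apply: val_inj; rewrite /= val_coxeter_full j0 eqxx.
  rewrite bm -val_eqE /= val_coxeter_full; case: eqP => //; case: eqP => //; try lia.
  by have := ltn_ord i; lia.
apply: b0; rewrite !val_coxeter_full (negPf j0) ifF; first by lia.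
by apply/eqP; lia.
Qed.

(** In b = b' h, the factor b' passes c to the left, stays in the Borel and is absorbed by e; only
    the average over h remains. *)
Lemma borel_idem_sigma : e *m P c *m e = e *m P c *m eH.
Proof.
have He h : h \in H -> e *m P h = e.
  by move=> hH; apply: borel_idem_r; apply: (subsetP last_col_group_borel).
have eeH : e *m eH = e.
  rewrite -[LHS]mulmx1 mulmx_averageE.
  by apply: average_const last_col_group_neq0 _ => h hH; rewrite mulmx1 He.
rewrite -{2}eeH mulmxA mulmx_averageE.
apply: average_const (borel_neq0 F d) _ => b bB.
have [b' [h [b'B hH -> bm _]]] := borel_last_col_split bB.
rewrite -!mulmxA -translationM -!mulmxA average_last_col_l //.
rewrite (mulmxA (P c)) translationM.
rewrite -[c *m b'](mulmxKV (unitmx_perm _ sigma)) -translationM !mulmxA.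
by rewrite borel_idem_r // sigma_conj_borel.
Qed.

Local Notation X := (P c *m eH).

(** Moving b to the left across one step absorbs its last column and conjugates the rest by c, which
    produces one more trivial leading column. After k steps nothing of b is left. *)
Lemma companion_pow_borel j b : (j <= k)%N -> b \in borel ->
  (forall i l : 'I_k, (l < k - j)%N -> b i l = (i == l)%:R) ->
  X ^+ j *m P b = X ^+ j.
Proof.
elim: j b => [|j IH] b jk bB bfix.
  have -> : b = 1%:M.
    by apply/matrixP => i l; rewrite bfix ?mxE // subn0.
  by rewrite translation1 mulmx1.
have [b' [h [b'B hH bE bm b'E]]] := borel_last_col_split bB.
rewrite [in LHS]bE.
rewrite exprSr -mulmxE -!mulmxA -translationM (mulmxA eH) average_last_col_comm //.
rewrite -(mulmxA (P b')) average_last_col_r // (mulmxA (P c)) translationM.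
rewrite -[c *m b'](mulmxKV (unitmx_perm _ sigma)) -translationM !mulmxA.
congr (_ *m _ *m _); apply: IH; [by lia|exact: sigma_conj_borel|].
move=> i l lj; rewrite sigma_conjE -[in RHS](inj_eq (@perm_inj _ sigma)).
have [l0|l0] := eqVneq (l : nat) 0%N.
  have -> : sigma l = ord_max by apply: val_inj; rewrite /= val_coxeter_full l0 eqxx.
  by rewrite bm.
have [->|lm] := eqVneq (sigma l) ord_max; first by rewrite bm.
by rewrite b'E // bfix // val_coxeter_full (negPf l0); lia.
Qed.

Lemma companion_pow_idem n : (k <= n)%N -> X ^+ n *m e = X ^+ n.
Proof.
move=> kn; rewrite -(subnK kn) exprD -mulmxE -mulmxA; congr (_ *m _).
rewrite -[LHS]mulmx1 mulmx_averageE.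
apply: average_const (borel_neq0 F d) _ => b bB; rewrite mulmx1.
by apply: companion_pow_borel => // i l; rewrite subnn.
Qed.

Lemma trace_double_coset_sigma_pow n : (k <= n)%N ->
  \tr (dc c ^+ n) = \tr (X ^+ n).
Proof.
move=> kn; rewrite -(companion_pow_idem kn) mxtrace_mulC.
rewrite [e *m _](_ : _ = e * X ^+ n) //.
rewrite -(sandwich_pow n (borel_idemM K F d) borel_idem_sigma).
congr mxtrace; case: n kn => // n _.
by rewrite -[LHS]/(dc c ^+ n.+1) exprS mulrA [e * dc c]double_coset_idem_l.
Qed.

Lemma card_field_nonzero : #|[pred x : F | x != 0]| = #|F|.-1.
Proof. by rewrite cardC1. Qed.

Lemma card_last_col_group : #|H| = (#|F|.-1 * #|F| ^ d)%N.
Proof.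
pose Q (i j : 'I_k) : pred F := if j == ord_max
  then (if i == ord_max then [pred x | x != 0] else predT)
  else pred1 (i == j)%:R.
have -> : H = [set A : 'M[F]_k | [forall i, forall j, Q i j (A i j)]].
  apply/setP => x; rewrite [RHS]inE; apply/idP/idP => [xH|/forallP xQ].
    have [_ hx] := last_col_groupP _ xH.
    have xd := borel_diag_neq0 ord_max (subsetP last_col_group_borel _ xH).
    apply/forallP => i; apply/forallP => j; rewrite /Q.
    have [->|jm] := eqVneq j ord_max; first by case: eqP => [->|].
    by rewrite /=; have /colP/(_ i) := hx j jm; rewrite !mxE => ->.
  have xE i j : j != ord_max -> x i j = (i == j)%:R.
    by move=> jm; have /forallP/(_ j) := xQ i; rewrite /Q (negPf jm) => /eqP.
  apply/last_col_groupP; split; last first.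
    by move=> j jm; apply/colP => i; rewrite !mxE xE.
  apply: borel_unit; apply: borel_diag => [i j ji|i].
    rewrite xE; first by rewrite -val_eqE gtn_eqF.
    by apply: contraTneq ji => ->; rewrite -leqNgt -ltnS.
  have [->|im] := eqVneq i ord_max; last by rewrite xE // eqxx oner_neq0.
  by have /forallP/(_ ord_max) := xQ ord_max; rewrite /Q eqxx.
rewrite card_entrywise exchange_big (bigD1 ord_max) //= [X in (_ * X)%N]big1.
  rewrite muln1 (bigD1 ord_max) //= /Q !eqxx card_field_nonzero; congr (_ * _)%N.
  rewrite (eq_bigr (fun=> #|F|)) => [|i im]; last first.
    by rewrite (negPf im); apply: eq_card.
  by rewrite prod_nat_const cardC1 card_ord.
move=> j jm; rewrite big1 // => i _.
by rewrite /Q (negPf jm) card1.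
Qed.

Lemma card_borel : #|borel| = (#|F|.-1 ^ k * #|F| ^ 'C(k, 2))%N.
Proof.
pose Q (i j : 'I_k) : pred F := if (j < i)%N then pred1 0 else
  if i == j then [pred x | x != 0] else predT.
have -> : borel = [set A : 'M[F]_k | [forall i, forall j, Q i j (A i j)]].
  apply/setP => x; rewrite [RHS]inE; apply/idP/idP => [xB|/forallP xQ].
    have [_ x0] := borelP _ xB.
    apply/forallP => i; apply/forallP => j; rewrite /Q.
    case: ifP => [ji|_]; first by rewrite /= x0.
    by case: eqP => [<-|//]; rewrite /= borel_diag_neq0.
  apply: borel_diag => [i j ji|i].
    by have /forallP/(_ j) := xQ i; rewrite /Q ji => /eqP.
  by have /forallP/(_ i) := xQ i; rewrite /Q ltnn eqxx.
rewrite card_entrywise.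
have QE (i j : 'I_k) : #|Q i j| =
    ((if i == j then #|F|.-1 else 1) * (if (i < j)%N then #|F| else 1))%N.
  rewrite /Q -val_eqE /=; case: ltngtP => ij.
  - by rewrite card1.
  - by rewrite mul1n; apply: eq_card.
  - by rewrite card_field_nonzero muln1.
rewrite (eq_bigr (fun i : 'I_k => #|F|.-1 *
    \prod_(j < k) (if (i < j)%N then #|F| else 1)))%N; last first.
  move=> i _; under eq_bigr => j _ do rewrite QE.
  rewrite big_split /=; congr (_ * _)%N.
  rewrite (bigD1 i) //= eqxx big1 ?muln1 // => j ji.
  by rewrite eq_sym (negPf ji).
rewrite big_split /= prod_nat_const card_ord; congr (_ * _)%N.
rewrite exchange_big /= (eq_bigr (fun j : 'I_k => #|F| ^ j)%N) => [|j _].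
  by rewrite -expn_sum -(big_mkord predT id) bin2_sum.
by rewrite -big_mkcond /= (big_ord_narrow (ltnW (ltn_ord j))) prod_nat_const
  card_ord.
Qed.

Definition companion_step : 'M[K]_N := \sum_(h in H) P (c *m h).

Section CornerTrace.
Variables (r : nat) (L : 'M[K]_(N, r.+1)) (M : 'M[K]_(r.+1, N)).
Hypotheses (LM : L *m M = e) (ML : M *m L = 1%:M).
Local Notation gen := (@hecke_gen K F d).

(** Origin of (q - 1)^n: the chain is q^d times the double coset of c, whereas the walk step is |H|
    times X with |H| = (q - 1) q^d. *)
Lemma trace_corner_chain_pow n : (k <= n)%N ->
  (q - 1) ^+ n * \tr (hecke_chain (corner L M \o gen) 0 d ^+ n) =
  \tr (companion_step ^+ n).
Proof.
move=> kn; have F1 : (0 < #|F|.-1)%N.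
  by rewrite -card_field_nonzero; apply/card_gt0P; exists 1; rewrite inE oner_neq0.
have qE : (#|F|.-1)%:R = q - 1 by rewrite -subn1 natrB //; lia.
have X_scale : X = #|H|%:R^-1 *: companion_step.
  rewrite /average -scalemxAr mulmx_sumr; congr (_ *: _).
  by apply: eq_bigr => h _; rewrite translationM.
have corner_pow m : corner L M (dc c) ^+ m.+1 = corner L M (dc c ^+ m.+1).
  elim: m => [//|m IH]; rewrite exprSr IH [LHS](cornerM LM) ?exprSr //.
  by rewrite -exprSr exprSr -mulmxE -mulmxA double_coset_idem_r.
have n0 : n = n.-1.+1 by lia.
have corner_pow_n : corner L M (dc c) ^+ n = corner L M (dc c ^+ n).
  by rewrite n0 corner_pow.
rewrite (corner_chain LM ML) // exprZn mxtraceZ corner_pow_n.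
rewrite (trace_corner LM); last first.
  by rewrite n0 exprSr -mulmxE -mulmxA double_coset_idem_r.
rewrite trace_double_coset_sigma_pow // X_scale scalemx_exp mxtraceZ.
rewrite card_last_col_group natrM natrX qE exprVn exprMn.
have q0 : q != 0 by rewrite pnatr_eq0; lia.
have q1 : q - 1 != 0 by rewrite -qE pnatr_eq0 -lt0n.
by rewrite mulrA mulrA divff ?mul1r // mulf_neq0 ?expf_neq0.
Qed.

End CornerTrace.
End CompanionWalks.

(** * Closed walks of companion steps *)

Section ClosedWalks.
Variables (K : numFieldType) (T : finType) (R : rel T).

Definition adjacency : 'M[K]_#|T| :=
  \matrix_(i, j) (R (enum_val i) (enum_val j))%:R.

Lemma adjacency_pow m i j : (adjacency ^+ m.+1) i j =
  \sum_(p : m.-tuple T) (path R (enum_val i) (rcons p (enum_val j)))%:R.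
Proof.
elim: m i => [|m IH] i.
  rewrite expr1 mxE (bigD1 [tuple]) //= big1 ?addr0 ?andbT // => p.
  by case/eqP; rewrite (tuple0 p).
rewrite exprS -mulmxE mxE.
rewrite (reindex (fun u : T * m.-tuple T => cons_tuple u.1 u.2)) /=; last first.
  exists (fun p => (thead p, behead_tuple p)) => [[x p] _|p _] /=.
    by congr (_, _); apply: val_inj.
  by rewrite [RHS]tuple_eta; apply: val_inj.
rewrite -(pair_bigA_idem _ (fun x (p : m.-tuple T) =>
  (R (enum_val i) x && path R x (rcons p (enum_val j)))%:R)) /=; last by rewrite addr0.
rewrite (reindex (fun l : 'I_#|T| => enum_val l)) /=; last first.
  by exists enum_rank => x _; rewrite ?enum_valK ?enum_rankK.
apply: eq_bigr => l _; rewrite IH mxE mulr_sumr; apply: eq_bigr => p _.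
by rewrite -natrM mulnb.
Qed.

Lemma trace_adjacency_pow n : (0 < n)%N ->
  \tr (adjacency ^+ n) = #|[set t : n.-tuple T | path.cycle R t]|%:R.
Proof.
case: n => // n _; rewrite /mxtrace.
under eq_bigr do rewrite adjacency_pow.
rewrite -sum1_card natr_sum [RHS]big_mkcond /=.
rewrite [RHS](reindex (fun u : T * n.-tuple T => cons_tuple u.1 u.2)) /=; last first.
  exists (fun p => (thead p, behead_tuple p)) => [[x p] _|p _] /=.
    by congr (_, _); apply: val_inj.
  by rewrite [RHS]tuple_eta; apply: val_inj.
rewrite -(pair_bigA_idem _ (fun x (p : n.-tuple T) =>
  if cons_tuple x p \in [set t : n.+1.-tuple T | path.cycle R t] then 1%N%:R : K else 0)) /=;
  last by rewrite addr0.
rewrite [RHS](reindex (fun l : 'I_#|T| => enum_val l)) /=; last first.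
  by exists enum_rank => x _; rewrite ?enum_valK ?enum_rankK.
apply: eq_bigr => l _; apply: eq_bigr => p _.
by rewrite inE /=; case: path.
Qed.

End ClosedWalks.

Lemma cycle_tnthP (T : eqType) (R : rel T) n (t : n.-tuple T) :
  reflect (forall i, R (tnth t i) (tnth t (ordS i))) (path.cycle R t).
Proof.
case: n t => [|n] t; first by rewrite (tuple0 t); apply: (iffP idP) => // _ [].
case/tupleP: t => x t; have sz : size (rcons t x) = n.+1 by rewrite size_rcons size_tuple.
have nthS (i : 'I_n.+1) : nth x (rcons t x) i = tnth [tuple of x :: t] (ordS i).
  rewrite (tnth_nth x) /= nth_rcons size_tuple.
  have := ltn_ord i; rewrite ltnS leq_eqVlt => /orP[/eqP->|ilt].
    by rewrite ltnn eqxx modnn.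
  by rewrite ilt modn_small.
have nthE (i : 'I_n.+1) : nth x (x :: rcons t x) i = tnth [tuple of x :: t] i.
  by rewrite (tnth_nth x) -rcons_cons nth_rcons /= size_tuple ltn_ord.
apply: (iffP (pathP x)) => [tR i|tR i].
  by rewrite -nthS -nthE; apply: tR; rewrite sz.
by rewrite sz => i_lt; have := tR (Ordinal i_lt); rewrite -nthS -nthE.
Qed.

Section Windows.
Variables (K : numFieldType) (F : finFieldType) (d : nat).
Local Notation k := d.+1.
Local Notation N := #|{: GLmx F d}|.

Definition step (g g' : GLmx F d) : bool :=
  [forall l : 'I_d, col (inord l.+1) (val g) == col (inord l) (val g')].

Lemma companion_step_adjacency : companion_step K F d = adjacency K step.
Proof.
apply/matrixP => i j; rewrite /companion_step summxE mxE.
set g := enum_val i; set g' := enum_val j.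
set c := perm_mx _.
have ug := valP g; have ug' := valP g'.
have ugc : val g *m c \in unitmx by rewrite unitmx_mul ug unitmx_perm.
pose h := invmx (val g *m c) *m val g'.
have gh h' : (translation K (c *m h')) i j = (h' == h)%:R.
  rewrite mxE -/g -/g' mulmxA; congr (_%:R); congr nat_of_bool.
  rewrite /h; apply/eqP/eqP => [<-|->]; last by rewrite mulKVmx.
  by rewrite mulKmx.
under eq_bigr do rewrite gh.
have -> : step g g' = (h \in last_col_group F d).
  have gcE l : (l < d)%N -> col (inord l) (val g *m c) = col (inord l.+1) (val g).
    move=> ld; apply/colP => a; rewrite !mxE.
    rewrite (bigD1 (inord l.+1)) //= big1 ?addr0 => [|b bl].
      rewrite perm_mxE -val_eqE /= val_coxeter_full !inordK //; try lia.
      by rewrite eqxx mulr1.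
    rewrite perm_mxE -val_eqE /= val_coxeter_full inordK; last by lia.
    case: ifP => /eqP b0; case: (_ =P l) => bE; rewrite ?mulr0 //; try lia.
    by case/eqP: bl; apply: val_inj; rewrite /= inordK; lia.
  have hE : val g' = val g *m c *m h by rewrite mulKVmx.
  apply/forallP/last_col_groupP => [gg|[uh hh] l].
    split=> [|a am]; first by rewrite unitmx_mul unitmx_inv ugc.
    have ad : (a < d)%N.
      by move: am; rewrite -val_eqE /=; have := ltn_ord a; lia.
    have /eqP := gg (Ordinal ad); rewrite /= -gcE // inord_val => e.
    have -> : col a h = invmx (val g *m c) *m col a (val g').
      by rewrite !colE mulmxA.
    by rewrite -e !colE mulmxA mulVmx.
  have -> : col (inord l) (val g') = val g *m c *m col (inord l) h.
    by rewrite [in LHS]hE !colE -[LHS]mulmxA.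
  apply/eqP; rewrite -(gcE l) // hh; first by rewrite !colE mul1mx.
  by rewrite -val_eqE /= inordK; have := ltn_ord l; lia.
case: (boolP (h \in _)) => hH.
  rewrite (bigD1 h) //= eqxx big1 ?addr0 // => h' /andP[_ hh'].
  by rewrite (negPf hh').
rewrite big1 // => h' h'H; case: eqP => // e.
by rewrite -e h'H in hH.
Qed.

Definition windows_invertible (n : nat) : {set 'M[F]_(k, n)} :=
  [set A : 'M[F]_(k, n) | [forall i, colsub (@cyclic_interval k n i) A \in unitmx]].

Lemma card_closed_walks n :
  #|[set t : n.-tuple (GLmx F d) | path.cycle step t]| = #|windows_invertible n|.
Proof.
(* The first columns of the windows recover the walk: column l of a window is the first column of
   the window l steps later. *)
pose Psi (t : n.-tuple (GLmx F d)) : 'M[F]_(k, n) :=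
  \matrix_(a, i) val (tnth t i) a ord0.
have walkE (t : n.-tuple (GLmx F d)) i : path.cycle step t ->
    colsub (@cyclic_interval k n i) (Psi t) = val (tnth t i).
  move=> /(cycle_tnthP step) tS; apply/matrixP => a l; rewrite !mxE /cyclic_interval.
  rewrite -[l in RHS]inord_val; case: l => l l_lt /=.
  elim: l i l_lt => [|l IH] i l_lt.
    by congr (fun_of_matrix _ _ _); apply: val_inj; rewrite /= inordK.
  have ld : (l < d)%N by [].
  have /forallP/(_ (Ordinal ld))/eqP/colP/(_ a) := tS i; rewrite !mxE /= => ->.
  by rewrite -IH 1?ltnW // -iterSr.
have Psi_inj : {in [set t : n.-tuple (GLmx F d) | path.cycle step t] &,
    injective Psi}.
  move=> t t'; rewrite !inE => tC t'C tt'; apply: eq_from_tnth => i.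
  by apply: val_inj; rewrite -!walkE // tt'.
rewrite -(card_in_imset Psi_inj); apply: eq_card => A; rewrite [RHS]inE.
apply/imsetP/forallP => [[t + -> i]|AW].
  by rewrite inE => tC; rewrite walkE //; apply: valP.
pose g i : GLmx F d := Sub (colsub (@cyclic_interval k n i) A) (AW i).
have PsiE : A = Psi [tuple g i | i < n].
  by apply/matrixP => a i; rewrite !mxE tnth_mktuple !mxE.
exists [tuple g i | i < n] => //; rewrite inE; apply/cycle_tnthP => i.
rewrite !tnth_mktuple; apply/forallP => l; apply/eqP/colP => a; rewrite !mxE.
rewrite /cyclic_interval !inordK; try by have := ltn_ord l; lia.
by rewrite iterSr.
Qed.

End Windows.

(** * Matrices with invertible cyclic windows *)

(** Since each product of the two symmetrizers is a sum of two neighbouring hooks, the factor x - 1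
    converts the hook sum into a sum over these products. At x = q^n it becomes the q^n - 1 of the
    final count. *)
Lemma hook_trace_gen_fun (K : numFieldType) (R : algType K) (q x : K)
    (T : nat -> R) theta k : 0 < q -> (0 < k)%N ->
  hecke_family q T k -> trace_on T k theta ->
  (x - 1) * \sum_(a < k) (-1) ^+ (k - a).-1 * hook_trace q T theta k a * x ^+ a =
  \sum_(a < k.+1) (-1) ^+ (k - a) * x ^+ a * theta (sym_asym q T k a).
Proof.
move=> q0 k0 TH tr.
pose h a : K := if (a < k)%N then hook_trace q T theta k a else 0.
pose c a : K := (-1) ^+ (k - a) * x ^+ a.
rewrite [RHS](eq_bigr (fun a : 'I_k.+1 => c a * h a +
    c a * (if (0 < a)%N then h a.-1 else 0))); last first.
  move=> a _; have ak : (a <= k)%N by rewrite -ltnS.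
  rewrite (trace_sym_asym q0 k0 ak TH tr) -mulrDr; congr (_ * (_ + _)).
  by rewrite /h; case: ifP => // a0; rewrite ifT //; lia.
rewrite [RHS]big_split /= [X in _ = X + _]big_ord_recr.
rewrite [X in _ = _ + X]big_ord_recl /=.
rewrite {2}/h ltnn !mulr0 addr0 add0r -big_split /= mulr_sumr.
apply: eq_bigr => a _; have ak := ltn_ord a.
rewrite /c /h /bump leq0n add1n /= ak.
have -> : (k - a = (k - a.+1).+1)%N by lia.
by rewrite /= !exprS; ring.
Qed.

(** * Counting matrices of full row rank over a finite field *)

Section RowFree.
Variable F : finFieldType.

Lemma card_submx m n (A : 'M[F]_(m, n)) : row_free A ->
  #|[set v : 'rV[F]_n | (v <= A)%MS]| = (#|F| ^ m)%N.
Proof.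
move=> fA; rewrite -[m in RHS]mul1n -card_mx.
rewrite -cardsT -(card_imset _ (row_free_inj fA)); apply: eq_card => v.
rewrite inE; apply/submxP/imsetP => [[w ->]|[w _ ->]]; last by exists w.
by exists w.
Qed.

Lemma row_free_col_mx m n (v : 'rV[F]_n) (A : 'M[F]_(m, n)) :
  row_free (col_mx v A) = row_free A && ~~ (v <= A)%MS.
Proof.
rewrite /row_free -addsmxE; have rv := rank_leq_row v.
have le1 := mxrank_adds_leqif v A.
have rvA : (\rank (v + A) <= \rank v + \rank A)%N by rewrite le1.
have rA := rank_leq_row A.
have [vA|nvA] := boolP (v <= A)%MS.
  rewrite andbF (addsmx_idPr vA); apply/negbTE; rewrite neq_ltn; lia.
have ltA : (\rank A < \rank (v + A))%N.
  by apply: rank_ltmx; rewrite ltmxE addsmxSr /= addsmx_sub negb_and nvA.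
by rewrite andbT; apply/eqP/eqP; lia.
Qed.

Lemma card_row_free m n :
  #|[set A : 'M[F]_(m, n) | row_free A]| =
  (\prod_(i < m) (#|F| ^ n - #|F| ^ i))%N.
Proof.
elim: m => [|m IH].
  rewrite big_ord0; apply/eqP/cards1P; exists 0.
  by apply/setP => A; rewrite !inE (flatmx0 A) /row_free mxrank0 !eqxx.
rewrite big_ord_recr /= -IH -sum1_card -sum1_card big_distrl /=.
rewrite (reindex (fun u : 'M[F]_(m, n) * 'rV[F]_n => col_mx u.2 u.1 : 'M_(m.+1, n))) /=;
  last first.
  exists (fun A : 'M[F]_(1 + m, n) => (dsubmx A, usubmx A)) => [[A v] _|A _] /=.
    by rewrite col_mxKu col_mxKd.
  exact: (@vsubmxK F 1 m n A).
rewrite (eq_bigl (fun u : 'M[F]_(m, n) * 'rV[F]_n =>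
   (u.1 \in [set A | row_free A]) && (u.2 \in ~: [set v | (v <= u.1)%MS]))).
  rewrite -(pair_big_dep (fun A => A \in [set A : 'M[F]_(m, n) | row_free A])
    (fun A (v : 'rV[F]_n) => v \in ~: [set v | (v <= A)%MS]) (fun _ _ => 1%N)) /=.
  apply: eq_bigr => A; rewrite inE => fA; rewrite sum1_card mul1n cardsCs setCK.
  by rewrite card_submx // card_mx mul1n.
by case=> A v; rewrite !inE row_free_col_mx.
Qed.

Lemma card_GLmx d : #|{: GLmx F d}| = (\prod_(i < d.+1) (#|F| ^ d.+1 - #|F| ^ i))%N.
Proof.
rewrite -card_row_free card_sig; apply: eq_card => A.
by rewrite !inE row_free_unit.
Qed.

End RowFree.

Lemma prod_subX_qfact (K : numFieldType) (q : K) k :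
  \prod_(i < k) (q ^+ k - q ^+ i) = q ^+ 'C(k, 2) * (q - 1) ^+ k * qfact q k.
Proof.
have -> : \prod_(i < k) (q ^+ k - q ^+ i) =
    \prod_(i < k) (q ^+ i * ((q - 1) * qnum q (k - i))).
  apply: eq_bigr => i _; rewrite qnum_geom mulrBr mulr1 -exprD subnKC //.
  exact: ltnW.
rewrite !big_split /= prodr_const card_ord -expr_sum mulrA.
congr (_ ^+ _ * _ * _); first by rewrite -bin2_sum big_mkord.
rewrite (reindex_inj rev_ord_inj) /=; apply: eq_bigr => i _.
by congr (qnum _ _); have := ltn_ord i; lia.
Qed.

Lemma qnum_aut (q : algC) n (u : {rmorphism algC -> algC}) :
  u (qnum q n) = qnum (u q) n.
Proof. by rewrite rmorph_sum; apply: eq_bigr => i _; rewrite rmorphXn. Qed.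

Lemma qfact_aut (q : algC) n (u : {rmorphism algC -> algC}) :
  u (qfact q n) = qfact (u q) n.
Proof. by rewrite rmorph_prod; apply: eq_bigr => i _; rewrite /= qnum_aut. Qed.

Section WindowsCount.
Variables (F : finFieldType) (d n : nat).
Local Notation k := d.+1.
Local Notation q := (#|F|%:R : algC).
Local Notation e := (borel_idem algC F d).
Local Notation gen := (@hecke_gen algC F d).
Local Notation N := #|{: GLmx F d}|.

Lemma card_field_gt1 : (1 < #|F|)%N.
Proof. by rewrite (cardD1 0) (cardD1 1) !inE oner_neq0. Qed.

Section Corner.
Variables (r : nat) (L : 'M[algC]_(N, r.+1)) (M : 'M[algC]_(r.+1, N)).
Hypotheses (LM : L *m M = e) (ML : M *m L = 1%:M).
Local Notation T := (corner L M \o gen).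

Let q0 : 0 < q.
Proof. by rewrite ltr0n; apply: ltnW card_field_gt1. Qed.

Let q1 : q - 1 != 0.
Proof. by rewrite subr_eq0 pnatr_eq1; have := card_field_gt1; case: eqP => // ->. Qed.

(** The rank of e is the index of the Borel in GL_k, that is, the number of complete flags. This
    [k]! is the numerator of the q-binomial coefficients. *)
Lemma corner_size : r.+1%:R = qfact q k.
Proof.
have : r.+1%:R = \tr e.
  by rewrite -LM mxtrace_mulC ML mxtrace1.
rewrite trace_borel_idem card_GLmx card_borel natr_prod => ->.
rewrite (eq_bigr (fun i : 'I_k => q ^+ k - q ^+ i)) => [|i _]; last first.
  rewrite natrB ?natrX // leq_exp2l ?card_field_gt1 //; exact: ltnW.
rewrite prod_subX_qfact natrM !natrX -subn1 natrB; last exact: ltnW card_field_gt1.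
have qn : q != 0 by rewrite gt_eqF.
rewrite [X in X * _ / _]mulrC mulrAC divff ?mul1r //.
by rewrite mulf_neq0 ?expf_neq0.
Qed.

Lemma trace_on_corner : trace_on T k (fun X : 'M_r.+1 => \tr X).
Proof.
split; [exact: mxtraceD|exact: mxtraceZ|].
by move=> X j _; rewrite -!mulmxE mxtrace_mulC.
Qed.

Lemma hook_trace_corner_aut a (u : {rmorphism algC -> algC}) : (a < k)%N ->
  u (hook_trace q T (fun X : 'M_r.+1 => \tr X) k a) =
  hook_trace q T (fun X : 'M_r.+1 => \tr X) k a.
Proof.
move=> ak.
rewrite (hook_trace_rec q0 ak (hecke_family_corner LM ML) trace_on_corner).
rewrite rmorph_sum; apply: eq_bigr => b _ /=.
rewrite rmorphM rmorphXn rmorphN1 trace_corner_sym_asym //; last first.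
  by have := ltn_ord b; lia.
by rewrite fmorph_div rmorph_nat rmorphM !qfact_aut fmorphV !rmorph_nat.
Qed.

Lemma trace_corner_chain_coprime : (0 < n)%N -> coprime n k ->
  (q ^+ n - 1) * \tr (hecke_chain T 0 d ^+ n) = \prod_(i < k) (q ^+ n - q ^+ i).
Proof.
move=> n0 co; have TH := hecke_family_corner LM ML.
pose tau (X : 'M[algC]_r.+1) := \tr X.
rewrite (trace_power_galois (k := k)
  (t := fun a => (-1) ^+ (k - a).-1 * hook_trace q T tau k a)
  (x := fun a => q ^+ a)) //; first last.
- move=> m; apply: (@trace_chain_pow _ _ q T q0 tau k m) => //.
    by move=> X Y; rewrite /tau -!mulmxE mxtrace_mulC.
  exact: trace_on_corner.
- by move=> b u bk; rewrite rmorphM rmorphXn rmorphN1 /= hook_trace_corner_aut.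
(* Reading (q^a)^n as (q^n)^a puts the sum in the form of the generating function at x = q^n. *)
under eq_bigr => a _ do rewrite -exprM mulnC exprM.
rewrite (hook_trace_gen_fun (q ^+ n) q0 _ TH trace_on_corner) //.
rewrite -(q_binomial_theorem _ _ q0); apply: eq_bigr => a _.
by rewrite trace_corner_sym_asym -?corner_size // -ltnS.
Qed.

End Corner.

Lemma card_windows_invertible : (k <= n)%N -> coprime k n ->
  (#|windows_invertible F d n| * (#|F| ^ n).-1 =
   #|F|.-1 ^ n * \prod_(i < k) (#|F| ^ n - #|F| ^ i))%N.
Proof.
move=> kn co; have n0 : (0 < n)%N by lia.
have F1 := card_field_gt1; have F0 := ltnW F1.
have [r [L [M [LM ML]]]] := idempotent_splitting (borel_idemM _ _ _) (borel_idem_neq0 algC F d).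
have := trace_corner_chain_pow LM ML kn.
rewrite companion_step_adjacency trace_adjacency_pow // card_closed_walks => Wn.
apply/eqP; rewrite -(eqr_nat algC) !natrM -Wn natr_prod natrX; apply/eqP.
have predE m : (0 < m)%N -> m.-1%:R = m%:R - 1 :> algC.
  by move=> m0; rewrite -subn1 natrB.
rewrite !predE ?expn_gt0 ?F0 // natrX.
rewrite -mulrA [_ * (q ^+ n - 1)]mulrC trace_corner_chain_coprime //; last first.
  by rewrite coprime_sym.
congr (_ * _); apply: eq_bigr => i _; rewrite natrB ?natrX //.
by rewrite leq_exp2l //; have := ltn_ord i; lia.
Qed.

End WindowsCount.

(** * Fibers over the Grassmannian *)

Lemma row_free_eqmx_unit (K : fieldType) k m n
    (A : 'M[K]_(k, n)) (B : 'M[K]_(m, n)) (e : m = k) :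
  row_free A -> (A :=: B)%MS ->
  exists2 X : 'M[K]_(k, m), row_free X & A = X *m B.
Proof.
case: k / e A => A fA AB.
have /submxP[X AX] : (A <= B)%MS by rewrite AB.
by exists X => //; rewrite /row_free eqn_leq rank_leq_row /= -{1}(eqP fA) AX mxrankM_maxl.
Qed.

Lemma colsub_mulmx (K : pzSemiRingType) k m n p (c : 'I_p -> 'I_n)
    (X : 'M[K]_(k, m)) (B : 'M[K]_(m, n)) :
  colsub c (X *m B) = X *m colsub c B.
Proof.
by apply/matrixP => i j; rewrite !mxE; apply: eq_bigr => l _; rewrite mxE.
Qed.

Lemma cyclic_minors_neq0E (K : fieldType) k n (V : 'M[K]_n) (A : 'M[K]_(k, n)) :
  row_free A -> (V :=: A)%MS ->
  cyclic_minors_neq0 V =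
  [forall r, colsub (@cyclic_interval k n r) A \in unitmx].
Proof.
move=> fA VA; have rk : \rank V = k by rewrite VA (eqP fA).
apply: eq_forallb => r; rewrite /plucker.
have : (A :=: row_base V)%MS.
  by apply: eqmx_trans (eqmx_sym VA) (eqmx_sym (eq_row_base V)).
move: (row_base V); case: _ / (esym rk) => B AB.
have [X fX ->] := row_free_eqmx_unit (erefl k) fA AB.
have uX : X \in unitmx by rewrite -row_free_unit.
by rewrite colsub_mulmx unitmx_mul uX /= unitmxE unitfE.
Qed.

Lemma cyclic_windows_row_free (K : fieldType) k n (A : 'M[K]_(k, n)) :
  (0 < n)%N -> [forall r, colsub (@cyclic_interval k n r) A \in unitmx] ->
  row_free A.
Proof.
move=> n0 /forallP/(_ (Ordinal n0)); set c := cyclic_interval _.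
rewrite -row_free_unit /row_free => /eqP rc; rewrite eqn_leq rank_leq_row /=.
by rewrite -{1}rc -[A in colsub _ A]mulmx1 colsub_mulmx mxrankM_maxl.
Qed.

Lemma GrP (F : finFieldType) k n (V : 'M[F]_n) : (k <= n)%N ->
  reflect (exists2 A : 'M[F]_(k, n), row_free A & V = <<A>>%MS) (V \in Gr F k n).
Proof.
move=> kn; apply: (iffP imsetP) => -[A].
  rewrite inE => /eqP rA ->; have := row_base_free A.
  have : (<<row_base A>> = <<A>>)%MS by apply/eq_genmx/eq_row_base.
  by move: (row_base A); rewrite rA => B <- fB; exists B.
move=> fA ->; exists <<A>>%MS; last by rewrite genmx_id.
by rewrite inE mxrank_gen (eqP fA).
Qed.

(** The fiber over a subspace is the free GL_k-orbit of any of its bases. *)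
Lemma card_Gr_fibers (F : finFieldType) k n (P : pred 'M[F]_n) : (k <= n)%N ->
  #|[set A : 'M[F]_(k, n) | row_free A & P <<A>>%MS]| =
  (#|[set V in Gr F k n | P V]| * #|[set X : 'M[F]_k | X \in unitmx]|)%N.
Proof.
move=> kn; rewrite -sum1_card.
rewrite (partition_big (fun A : 'M[F]_(k, n) => <<A>>%MS)
  (fun V => V \in [set V in Gr F k n | P V])) /=; last first.
  move=> A; rewrite !inE => /andP[fA ->]; rewrite andbT.
  by apply/(GrP _ kn); exists A.
rewrite -sum_nat_const; apply: eq_bigr => V.
rewrite inE => /andP[/(GrP _ kn)[B fB ->] PB]; rewrite sum1_card.
rewrite -(card_imset _ (row_free_inj fB)).
apply: eq_card => A; rewrite unfold_in inE; apply/andP/imsetP.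
  case=> /andP[fA _] /eqP AB.
  have AB' : (A :=: B)%MS by apply/eqmxP/genmxP; rewrite AB.
  have [X fX ->] := row_free_eqmx_unit (erefl k) fA AB'.
  by exists X; rewrite // inE -row_free_unit.
case=> X; rewrite inE => uX ->.
have XB : (<<X *m B>> = <<B>>)%MS.
  by apply/eq_genmx/eqmxMfull; rewrite row_full_unit.
by rewrite XB PB /row_free mxrankMfree // andbT -row_free_unit in uX *.
Qed.

Section Counts.
Variables (F : finFieldType) (k n : nat).
Hypotheses (k0 : (0 < k)%N) (kn : (k <= n)%N).

Lemma card_unitmx_gt0 : (0 < #|[set X : 'M[F]_k | X \in unitmx]|)%N.
Proof. by apply/card_gt0P; exists 1%:M; rewrite inE unitmx1. Qed.

Lemma card_Gr_GL :
  (#|Gr F k n| * #|[set X : 'M[F]_k | X \in unitmx]| =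
   \prod_(i < k) (#|F| ^ n - #|F| ^ i))%N.
Proof.
rewrite -card_row_free; transitivity
  #|[set A : 'M[F]_(k, n) | row_free A & predT <<A>>%MS]|.
  rewrite card_Gr_fibers //; congr (_ * _)%N.
  by apply: eq_card => V; rewrite inE andbT.
by apply: eq_card => A; rewrite !inE andbT.
Qed.

Lemma card_open_positroid_GL :
  (#|open_positroid F k n| * #|[set X : 'M[F]_k | X \in unitmx]| =
   #|[set A : 'M[F]_(k, n) |
       [forall r, colsub (@cyclic_interval k n r) A \in unitmx]]|)%N.
Proof.
rewrite -card_Gr_fibers //; apply: eq_card => A; rewrite !inE.
have [fA|nfA] /= := boolP (row_free A).
  by rewrite (cyclic_minors_neq0E fA (genmxE A)).
apply/esym/negbTE; apply: contra nfA; apply: cyclic_windows_row_free.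
exact: leq_trans kn.
Qed.

Lemma card_open_positroid : coprime k n ->
  (#|open_positroid F k n| * (#|F| ^ n).-1 = #|Gr F k n| * #|F|.-1 ^ n)%N.
Proof.
move=> co; apply/eqP; rewrite -(eqn_pmul2r card_unitmx_gt0).
rewrite mulnAC card_open_positroid_GL mulnAC card_Gr_GL [X in _ == X]mulnC.
case: k k0 kn co => // d _ kn' co.
by rewrite -card_windows_invertible.
Qed.

End Counts.

(** * Tori in PGL_n *)

Lemma pgl_refl (K : finFieldType) n (A : 'M[K]_n) : A \in pgl A.
Proof. by apply/imsetP; exists 1; rewrite ?scale1r // inE oner_neq0. Qed.

Lemma pglP (K : finFieldType) n (A B : 'M[K]_n) :
  reflect (exists2 c, c != 0 & A = c *: B) (A \in pgl B).
Proof.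
by apply: (iffP imsetP) => -[c]; rewrite ?inE => c0 ->; exists c; rewrite ?inE.
Qed.

Lemma pgl_scale (K : finFieldType) n c (A : 'M[K]_n) :
  c != 0 -> pgl (c *: A) = pgl A.
Proof.
move=> c0; apply/setP => B; apply/pglP/pglP => -[a a0 ->].
  by exists (a * c); rewrite ?mulf_neq0 ?scalerA.
by exists (a / c); rewrite ?mulf_neq0 ?invr_eq0 // scalerA divfK.
Qed.

Lemma pgl_eq (K : finFieldType) n (A B : 'M[K]_n) :
  (pgl A == pgl B) = (A \in pgl B).
Proof.
apply/eqP/idP => [<-|]; first exact: pgl_refl.
by case/pglP => c c0 ->; exact: pgl_scale.
Qed.

Lemma card_pgl (K : finFieldType) n (A : 'M[K]_n) : A != 0 ->
  #|pgl A| = #|K|.-1.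
Proof.
move=> A0; rewrite card_imset ?cardC1 // => [|a b /eqP].
  by apply: eq_card_trans (cardC1 (0 : K)) _ => x; rewrite !inE.
by rewrite -subr_eq0 -scalerBl scaler_eq0 (negPf A0) orbF subr_eq0 => /eqP.
Qed.

Lemma card_pgl_classes (K : finFieldType) n (S : pred 'M[K]_n) :
  (forall A, S A -> A != 0) -> (forall c A, c != 0 -> S A -> S (c *: A)) ->
  (#|[set pgl A | A : 'M[K]_n & S A]| * #|K|.-1 = #|[set A | S A]|)%N.
Proof.
move=> S0 SZ; rewrite -[RHS]sum1_card.
rewrite (partition_big (fun A => pgl A)
  (fun C => C \in [set pgl A | A : 'M[K]_n & S A])) /=; last first.
  by move=> A; rewrite inE => SA; apply/imsetP; exists A; rewrite ?inE.
rewrite -sum_nat_const; apply: eq_bigr => C /imsetP[A].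
rewrite inE => SA ->; rewrite sum1dep_card -(card_pgl (S0 A SA)).
apply: eq_card => B; rewrite !inE pgl_eq andb_idl // => /pglP[c c0 ->].
exact: SZ.
Qed.

Lemma unitmx_neq0 (K : fieldType) n (A : 'M[K]_n) :
  (0 < n)%N -> A \in unitmx -> A != 0.
Proof.
move=> n0; apply: contraTneq => ->.
by rewrite -row_free_unit /row_free mxrank0 eq_sym -lt0n.
Qed.

Lemma diag_unitmxE (K : fieldType) n (D : 'M[K]_n) : is_diag_mx D ->
  (D \in unitmx) = [forall i, D i i != 0].
Proof.
move=> dD; rewrite unitmxE det_trig ?is_diag_mx_is_trig // unitfE.
by apply/prodf_neq0/forallP => D0 i //; apply: D0.
Qed.

Lemma card_diag_torus (K : finFieldType) n : (0 < n)%N ->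
  (#|diag_torus K n| * #|K|.-1 = #|K|.-1 ^ n)%N.
Proof.
move=> n0; rewrite (@card_pgl_classes K n (fun D => (D \in unitmx) && is_diag_mx D)).
- pose Q (i j : 'I_n) : pred K := if i == j then [pred x | x != 0] else pred1 0.
  transitivity #|[set A : 'M[K]_n | [forall i, forall j, Q i j (A i j)]]|.
    apply: eq_card => D; rewrite !inE; apply/andP/forallP => [[uD dD] i|DQ].
      apply/forallP => j; rewrite /Q; case: eqP => [<-|/eqP ij] /=.
        by move: uD; rewrite diag_unitmxE // => /forallP.
      by apply/eqP/(is_diag_mxP dD); rewrite (inj_eq val_inj).
    have dD : is_diag_mx D.
      apply/is_diag_mxP => i j; rewrite (inj_eq val_inj) => ij.
      by have /forallP/(_ j) := DQ i; rewrite /Q (negPf ij) /= => /eqP.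
    split=> //; rewrite diag_unitmxE //; apply/forallP => i.
    by have /forallP/(_ i) := DQ i; rewrite /Q eqxx.
  rewrite card_entrywise -[n in RHS]card_ord -prod_nat_const.
  apply: eq_bigr => i _; rewrite (bigD1 i) //= big1 ?muln1 => [|j ji].
    rewrite /Q eqxx; apply: eq_card_trans (cardC1 (0 : K)) _ => x.
    by rewrite !inE.
  by rewrite /Q eq_sym (negPf ji) card1.
- by move=> D /andP[uD _]; apply: unitmx_neq0.
move=> c D c0 /andP[uD /is_diag_mxP dD]; rewrite unitmxZ ?unitfE // uD.
by apply/is_diag_mxP => i j ij; rewrite mxE dD // mulr0.
Qed.

Section PowerMap.
Variables (R : comNzRingType) (q : nat).
Hypothesis q_pchar : [pchar R].-nat q.

(** The proof is an argument of the function so that the ring morphism structure can be attached to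
    it: additivity depends on q being a power of the characteristic. *)
Definition power_map of [pchar R].-nat q := fun x : R => x ^+ q.
Local Notation f := (power_map q_pchar).

Lemma power_map_nmod : nmod_morphism f.
Proof.
split; last by move=> x y; exact: exprDn_pchar.
by have /andP[q0 _] := q_pchar; rewrite /power_map expr0n gtn_eqF.
Qed.

Lemma power_map_monoid : monoid_morphism f.
Proof. by split; [exact: expr1n|move=> x y; exact: exprMn]. Qed.

End PowerMap.

HB.instance Definition _ (R : comNzRingType) q (qR : [pchar R].-nat q) :=
  GRing.isNmodMorphism.Build R R (@power_map R q qR) (power_map_nmod qR).
HB.instance Definition _ (R : comNzRingType) q (qR : [pchar R].-nat q) :=
  GRing.isMonoidMorphism.Build R R (@power_map R q qR) (power_map_monoid qR).

Lemma card_pchar (F : finFieldType) : [pchar F].-nat #|F|.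
Proof.
have [p pP pF] := finPcharP F.
have -> : #|F| = #|pPrimeCharType pF| by [].
by rewrite card_pprimeChar pnatX (eq_pnat _ (pcharf_eq pF)) pnat_id.
Qed.

Lemma card_pchar_ext (F : finFieldType) (L : nzRingType)
    (iota : {rmorphism F -> L}) : [pchar L].-nat #|F|.
Proof.
by apply: sub_in_pnat (card_pchar F) => p _; apply: rmorph_pchar.
Qed.

(** * Frobenius and the twisted variety *)

(* If s shifts the vectors v_j, a linear dependency between k consecutive ones
   confines all later ones to the same proper subspace. *)
Lemma semilinear_orbit_free (K : fieldType) k (s : {rmorphism K -> K})
    (v : nat -> 'rV[K]_k) (a : K) : a != 0 ->
  (forall j, map_mx s (v j) = a *: v j.+1) ->
  (forall M : 'M[K]_k, (forall j, (v j <= M)%MS) -> M \in unitmx) ->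
  (\matrix_(i < k) v i) \in unitmx.
Proof.
move=> a0 sv full; pose U m := \matrix_(i < m) v i.
have vU j m : (j < m)%N -> (v j <= U m)%MS.
  by move=> jm; apply: (eq_row_sub (Ordinal jm)); rewrite rowK.
have UU m : (U m <= U m.+1)%MS.
  by apply/row_subP => i; rewrite rowK vU // ltnS ltnW.
have [/existsP[[m mk] /= vm]|ind] :=
    boolP [exists m : 'I_k, (v m <= U m)%MS].
  have sU x : (x <= U m)%MS -> (map_mx s x <= U m)%MS.
    case/submxP => y ->; rewrite map_mxM; apply: mulmx_sub.
    apply/row_subP => i; rewrite -map_row rowK sv scalemx_sub //.
    have [im|mi] := ltnP i.+1 m; first exact: vU.
    by have -> : i.+1 = m by have := ltn_ord i; lia.
  have all_v j : (v j <= U m)%MS.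
    elim: j => [|j /sU]; last by rewrite sv (eqmx_scale _ a0).
    by case: (m) vm vU => // m' _ vU'; apply: vU'.
  have : <<U m>>%MS \in unitmx by apply: full => j; rewrite genmxE.
  rewrite -row_free_unit /row_free mxrank_gen => /eqP rU.
  by have := rank_leq_row (U m); rewrite rU leqNgt mk.
rewrite -row_free_unit /row_free eqn_leq rank_leq_row /=.
suff rk m : (m <= k)%N -> (m <= \rank (U m))%N by exact: rk.
elim: m => // m IH mk; apply: leq_ltn_trans (IH (ltnW mk)) _.
apply: rank_ltmx; rewrite ltmxE UU /=; apply: contra ind => UmS.
by apply/existsP; exists (Ordinal mk); apply: submx_trans UmS; apply: vU.
Qed.

Lemma iter_ordS n (r : 'I_n) j : iter j (@ordS n) r = ((r + j) %% n)%N :> nat.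
Proof.
elim: j => [|j IH]; first by rewrite addn0 modn_small.
by rewrite iterS /= IH -[(_ %% n).+1]addn1 modnDml addn1 addnS.
Qed.

Lemma iter_ord_pred n (r : 'I_n) j l : (j <= l)%N ->
  iter j (@ord_pred n) (iter l (@ordS n) r) = iter (l - j) (@ordS n) r.
Proof.
elim: j l => [|j IH] [|l] // jl; rewrite ?subn0 //.
by rewrite iterSr iterS ordSK IH.
Qed.

Section Twist.
Variables (F L : finFieldType) (iota : {rmorphism F -> L}) (n : nat).
Variable g : 'M[L]_n.
Local Notation q := #|F|.
Hypotheses (n_gt0 : (0 < n)%N) (cardL : #|L| = (q ^ n)%N).
Hypothesis g_unit : g \in unitmx.
Local Notation rho := (cyclic_perm_mx L n).
Hypothesis g_frob :
  pgl (invmx g *m map_mx (@geometric_frobenius L q) g) = pgl rho.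

Definition frob : {rmorphism L -> L} := power_map (card_pchar_ext iota).

Lemma frobE x : frob x = x ^+ q. Proof. by []. Qed.

Lemma iter_frob j x : iter j frob x = x ^+ (q ^ j).
Proof.
by elim: j => [|j IH] //=; rewrite IH frobE -exprM mulnC -expnS.
Qed.

Lemma frob_iota x : frob (iota x) = iota x.
Proof. by rewrite frobE -rmorphXn expf_card. Qed.

(** X^q - X has at most q roots, and the image of [iota] already provides q of them. *)
Lemma frob_fixed x : frob x = x -> exists y, x = iota y.
Proof.
move=> fx; pose p : {poly L} := 'X^q - 'X.
have q1 := card_field_gt1 F.
have szp : size p = q.+1.
  by rewrite size_polyDl ?size_polyXn // size_polyN size_polyX.
have p0 : p != 0 by rewrite -size_poly_eq0 szp.
pose S := [set y : L | root p y].
have SE y : (y \in S) = (y ^+ q == y).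
  by rewrite inE rootE !hornerE subr_eq0.
have cS : (#|S| <= q)%N.
  rewrite -ltnS -szp cardE; apply: max_poly_roots (enum_uniq _) => //.
  by apply/allP => y; rewrite mem_enum inE.
have sub : [set iota y | y : F] \subset S.
  apply/subsetP => _ /imsetP[y _ ->]; rewrite SE.
  by rewrite -rmorphXn expf_card.
have eS : [set iota y | y : F] = S.
  by apply/eqP; rewrite eqEcard sub (card_imset _ (fmorph_inj iota)).
have : x \in S by rewrite SE -frobE fx.
by rewrite -eS => /imsetP[y _ ->]; exists y.
Qed.

(** Applying x -> x^q entrywise to Fr(g) = c g rho undoes the geometric Frobenius and fixes rho,
    whose entries are 0 and 1. The scalar a is c^q. *)
Lemma frob_twist : exists2 a, a != 0 &
  g = a *: (map_mx frob g *m rho) /\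
  map_mx frob (invmx g) = a *: (rho *m invmx g).
Proof.
have /eqP := g_frob; rewrite pgl_eq => /pglP[c c0 gc].
have : map_mx frob (map_mx (@geometric_frobenius L q) g) = g.
  apply/matrixP => i j; rewrite !mxE; apply: (f_finv (f := frob)).
  exact: fmorph_inj.
rewrite -[map_mx _ g in X in X -> _](mulKVmx g_unit) gc -scalemxAr.
rewrite map_mxZ map_mxM /=.
have -> : map_mx frob rho = rho.
  by apply/matrixP => i j; rewrite !mxE rmorph_nat.
move=> gE; exists (frob c); first by rewrite fmorph_eq0.
split=> //; rewrite -[LHS](mulmxK g_unit) -[X in _ *m X *m _]gE.
rewrite -scalemxAr -scalemxAl; congr (_ *: _).
by rewrite mulmxA -map_mxM mulVmx // map_mx1 mul1mx.
Qed.

Lemma mul_tr_cyclic_perm_mx m (A : 'M[L]_(m, n)) i j :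
  (A *m rho^T) i (ordS j) = A i j.
Proof.
rewrite mxE (bigD1 j) //= !mxE eqxx mulr1 big1 ?addr0 // => l lj.
by rewrite !mxE (inj_eq (@ordS_inj n)) eq_sym (negPf lj) mulr0.
Qed.

Lemma twisted_minors k (A : 'M[F]_(k, n)) : (0 < k)%N -> row_free A ->
  forall r, colsub (@cyclic_interval k n r)
    (map_mx iota A *m (invmx g)^T) \in unitmx.
Proof.
move=> k0 fA r; set W := _ *m _; have [a a0 [_ ga]] := frob_twist.
have sW i j : frob (W i (ordS j)) = a * W i j.
  have : map_mx frob W = a *: (W *m rho^T).
    rewrite map_mxM -map_trmx ga -map_mx_comp.
    have -> : map_mx (frob \o iota) A = map_mx iota A.
      by apply/matrixP => i' j'; rewrite !mxE; apply: frob_iota.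
    by rewrite linearZ /= trmx_mul -scalemxAr mulmxA.
  move/matrixP/(_ i (ordS j)); rewrite mxE => ->.
  by rewrite mxE mul_tr_cyclic_perm_mx.
have rW : \rank W = k.
  rewrite mxrankMfree ?mxrank_map ?(eqP fA) //.
  by rewrite row_free_unit unitmx_tr unitmx_inv.
(* By [sW], Frobenius sends column j + 1 to a multiple of column j, so the orbit descends: the
   window is read backwards from its last column r'. *)
clearbody W; pose r' := iter k.-1 (@ordS n) r.
pose v j := row (iter j (@ord_pred n) r') W^T.
have vE j i : v j 0 i = W i (iter j (@ord_pred n) r') by rewrite !mxE.
have uv : (\matrix_(i < k) v i) \in unitmx.
  apply: (semilinear_orbit_free (s := frob) a0) => [j|M vM].
    apply/rowP => i; rewrite mxE vE [RHS]mxE vE iterS -sW.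
    by rewrite ord_predK.
  have WM : (W^T <= M)%MS.
    (* Going back r' + n - i places from r' reaches column i modulo n, so the orbit visits every
       column of W, and these have rank k together. *)
    apply/row_subP => i; have := vM (r' + (n - i))%N.
    have r'E : r' = iter (r' + (n - i)) (@ordS n) i.
      apply: ord_inj; rewrite iter_ordS addnCA subnKC ?(ltnW (ltn_ord i)) //.
      by rewrite modnDr modn_small.
    by rewrite /v {2}r'E iter_ord_pred // subnn.
  rewrite -row_free_unit /row_free eqn_leq rank_leq_row.
  by apply: leq_trans (mxrankS WM); rewrite mxrank_tr rW.
pose s : 'S_k := perm (@rev_ord_inj k).
have -> : colsub (@cyclic_interval k n r) W =
    (row_perm s (\matrix_(i < k) v i))^T.
  apply/matrixP => i j; rewrite !mxE permE iter_ord_pred /=; last by lia.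
  by congr (W _ (iter _ _ _)); have := ltn_ord j; lia.
by rewrite unitmx_tr row_permE unitmx_mul unitmx_perm.
Qed.

Lemma twisted_open_positroid_Gr k : (0 < k)%N -> (k <= n)%N ->
  twisted_open_positroid iota k g = Gr F k n.
Proof.
move=> k0 kn; apply/setP => V; rewrite inE andb_idr // => /(GrP _ kn)[A fA ->].
pose W := map_mx iota A *m (invmx g)^T.
have uh : row_free (invmx g)^T by rewrite row_free_unit unitmx_tr unitmx_inv.
have fW : row_free W by rewrite /row_free mxrankMfree ?mxrank_map.
rewrite (cyclic_minors_neq0E fW); first by apply/forallP; apply: twisted_minors.
by apply: eqmxMr; apply/map_eqmx; apply: genmxE.
Qed.

(** Rationality of g D g^-1 in the coordinates of the diagonal torus: Frobenius of g and of its
    inverse introduces rho on both sides, and the scalars cancel. *)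
Definition torus_frob_fixed (D : 'M[L]_n) : bool :=
  [&& is_diag_mx D, D \in unitmx & map_mx frob D *m rho == rho *m D].

Lemma torus_frob_fixedE (D : 'M[L]_n) : is_diag_mx D ->
  map_mx frob D *m rho = rho *m D <->
  forall j, frob (D (ordS j) (ordS j)) = D j j.
Proof.
move=> /diag_mxP[v ->]; rewrite map_diag_mx.
split=> [/matrixP E j|E].
  have := E (ordS j) j; rewrite mul_diag_mx mul_mx_diag !mxE !eqxx.
  by rewrite mulr1 mul1r !mulr1n.
apply/matrixP => i j; rewrite mul_diag_mx mul_mx_diag !mxE.
have [->|_] := eqVneq; last by rewrite mulr0 mul0r.
by have := E j; rewrite !mxE !eqxx !mulr1n mulr1 mul1r.
Qed.

(** Each entry is the q-th power of the next one, so D is determined by its last entry x as the list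
    of x^(q^(n-1-j)). The cycle closes because x^(q^n) = x in L; hence such D correspond to nonzero
    elements of L. *)
Lemma card_torus_frob_fixed : #|[set D | torus_frob_fixed D]| = (q ^ n).-1.
Proof.
pose f (x : L) : 'M[L]_n := diag_mx (\row_j x ^+ (q ^ (n - j.+1))).
have fE x i : f x i i = x ^+ (q ^ (n - i.+1)) by rewrite !mxE eqxx mulr1n.
have last_lt : (n.-1 < n)%N by lia.
pose m := Ordinal last_lt.
have fm x : f x m m = x by rewrite fE /= prednK // subnn.
have f_inj : injective f by move=> x y /matrixP/(_ m m); rewrite !fm.
have <- : #|[set f x | x : L in [pred x | x != 0]]| = (q ^ n).-1.
  rewrite card_imset // -cardL; apply: eq_card_trans (cardC1 (0 : L)) _ => x.
  by rewrite !inE.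
apply: eq_card => D; rewrite inE /torus_frob_fixed; apply/and3P/imsetP.
  case=> dD uD /eqP/(torus_frob_fixedE dD) sD.
  have D0 i : D i i != 0 by move: uD; rewrite diag_unitmxE // => /forallP.
  exists (D m m); first by rewrite inE.
  have /diag_mxP[v Dv] := dD; rewrite [LHS]Dv; congr diag_mx; apply/rowP => j.
  have DE t i : D i i = iter t frob (D (iter t (@ordS n) i) (iter t (@ordS n) i)).
    by elim: t i => //= t IH i; rewrite -iterS iterSr sD -IH.
  have jm : iter (n - j.+1) (@ordS n) j = m.
    apply: ord_inj; rewrite iter_ordS /=.
    by rewrite modn_small; have := ltn_ord j; lia.
  have -> : v 0 j = D j j by rewrite Dv mxE eqxx mulr1n.
  by rewrite mxE -iter_frob -jm -DE.
case=> x; rewrite inE => x0 ->; have dD := diag_mx_is_diag (\row_j x ^+ (q ^ (n - j.+1))).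
split=> //.
  by rewrite diag_unitmxE //; apply/forallP => i; rewrite fE expf_neq0.
apply/eqP/torus_frob_fixedE => // j; rewrite !fE frobE -exprM -expnSr.
have [jn|nj] := ltnP j.+1 n; first by rewrite /= modn_small // subnSK.
have -> : j.+1 = n by have := ltn_ord j; lia.
have -> : ordS j = Ordinal n_gt0.
  apply: ord_inj; rewrite /= (_ : j.+1 = n) ?modnn //.
  by have := ltn_ord j; lia.
by rewrite subnSK // subn0 subnn -cardL expf_card.
Qed.

Lemma frob_fixed_mx (B : 'M[L]_n) : map_mx frob B = B ->
  exists A, map_mx iota A = B.
Proof.
move=> /matrixP fB; exists (\matrix_(i, j) odflt 0 [pick y | iota y == B i j]).
apply/matrixP => i j; rewrite !mxE; case: pickP => [y /eqP //|noy].
have /frob_fixed[y By] : frob (B i j) = B i j by rewrite -[RHS]fB mxE.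
by have := noy y; rewrite By eqxx.
Qed.

(** Conjugation by g identifies the matrices over F representing a torus point with the D counted in
    [card_torus_frob_fixed]; each class modulo scalars of F contains q - 1 of them. *)
Lemma card_pgl_rational_points :
  (#|pgl_rational_points iota (conj_diag_torus g)| * q.-1 = (q ^ n).-1)%N.
Proof.
have [a a0 [ag ah]] := frob_twist.
have mulg m (X : 'M[L]_(m, n)) : X *m g = a *: (X *m map_mx frob g *m rho).
  by rewrite {1}ag -scalemxAr mulmxA.
pose h (A : 'M[F]_n) := invmx g *m map_mx iota A *m g.
have hK A : g *m h A *m invmx g = map_mx iota A.
  by rewrite /h !mulmxA mulmxV // mul1mx mulmxK.
have h_inj : injective h.
  by move=> A B AB; apply: (map_mx_inj (f := iota)); rewrite -!hK AB.
have h_frob A : map_mx frob (h A) *m rho == rho *m h A.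
  have iotaA : map_mx frob (map_mx iota A) = map_mx iota A.
    by apply/matrixP => i j; rewrite !mxE; apply: frob_iota.
  by rewrite /h 2!map_mxM iotaA ah -!scalemxAl !mulmxA mulg.
have hu A : (h A \in unitmx) = (A \in unitmx).
  by rewrite !unitmx_mul unitmx_inv g_unit andbT map_unitmx.
have hS A : (A \in unitmx) && (pgl (map_mx iota A) \in conj_diag_torus g) =
    torus_frob_fixed (h A).
  rewrite /torus_frob_fixed hu h_frob andbT andbC; apply: andb_id2r => uA.
  apply/imsetP/idP => [[D]|dA]; last first.
    by exists (h A); rewrite ?hK // inE hu uA.
  rewrite inE => /andP[uD /is_diag_mxP dD] /eqP; rewrite pgl_eq => /pglP[c c0 AE].
  rewrite /h AE -scalemxAr -scalemxAl !mulmxA mulVmx // mul1mx mulmxKV //.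
  by apply/is_diag_mxP => i j ij; rewrite mxE dD ?mulr0.
rewrite card_pgl_classes; first last.
- move=> c A c0; rewrite unitmxZ ?unitfE // map_mxZ pgl_scale //.
  by rewrite fmorph_eq0.
- by move=> A /andP[uA _]; apply: unitmx_neq0.
rewrite -card_torus_frob_fixed -(card_imset _ h_inj); apply: eq_card => D.
apply/imsetP/idP => [[A + ->]|]; first by rewrite !inE hS.
rewrite inE => DS; have /and3P[_ _ /eqP sD] := DS.
have [|A AE] := @frob_fixed_mx (g *m D *m invmx g).
  rewrite 2!map_mxM ah -scalemxAr !mulmxA -(mulmxA _ _ rho) sD !mulmxA.
  by rewrite -[X in _ = X *m D *m _]mul1mx mulg mul1mx -!scalemxAl.
have DE : D = h A by rewrite /h AE !mulmxA mulVmx // mul1mx mulmxKV.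
by exists A; rewrite // inE hS -DE.
Qed.

End Twist.

Theorem theorem1p2 (k n q : nat) (F L : finFieldType)
    (iota : {rmorphism F -> L}) (g : 'M[L]_n) (T' : {set {set 'M[L]_n}})
    (hk : (1 <= k)%N) (hkn : (k <= n)%N)
    (cop_kn : coprime k n) (cop_qn : coprime q n)
    (cardF : #|F| = q) (cardL : #|L| = (q ^ n)%N)
    (g_unit : g \in unitmx)
    (gT : conj_diag_torus g = T')
    (g_frob : pgl (invmx g *m map_mx (@geometric_frobenius L q) g)
              = pgl (cyclic_perm_mx L n)) :
  (#|open_positroid F k n|%:R / #|diag_torus F n|%:R : rat)
    = #|twisted_open_positroid iota k g|%:R
        / #|pgl_rational_points iota T'|%:R
  /\ (#|twisted_open_positroid iota k g|%:R
        / #|pgl_rational_points iota T'|%:R : rat)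
    = #|Gr F k n|%:R / #|pgl_rational_points iota T'|%:R.
Proof.

have k0 : (0 < k)%N by []; have n0 : (0 < n)%N := leq_trans k0 hkn.
have F1 := card_field_gt1 F; rewrite -cardF in cardL g_frob.
rewrite -gT (twisted_open_positroid_Gr iota n0 cardL g_unit g_frob) //; split=> //.
have posE := card_open_positroid F k0 hkn cop_kn.
have torusE := card_diag_torus F n0.
have torus'E := card_pgl_rational_points iota n0 cardL g_unit g_frob.
have q1 : (#|F|.-1 != 0)%N by lia.
have qn0 : (#|F|.-1 ^ n != 0)%N by rewrite expn_eq0 negb_and q1.
have Q0 : ((#|F| ^ n).-1 != 0)%N by have := ltn_expl n F1; lia.
have T0 : #|diag_torus F n| != 0%N.
  by apply: contra_neq qn0 => T0; rewrite -torusE T0.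
have T'0 : #|pgl_rational_points iota (conj_diag_torus g)| != 0%N.
  by apply: contra_neq Q0 => T'0; rewrite -torus'E T'0.
apply/eqP; rewrite eqr_div ?pnatr_eq0 // -!natrM eqr_nat.
(* The orders of both tori are known as multiples by q - 1; after this multiplication the equality
   is that of the point counts. *)
rewrite -(eqn_pmul2r (_ : 0 < #|F|.-1)%N) ?lt0n // -!mulnA torus'E torusE.
by rewrite posE.
Qed.
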